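(* Every nontrivial (i.e. not identically zero) homogeneous global solution $u$ is of one of the following forms, where $\theta_1\in[0,2\pi)$ and $\theta_2=\theta_1+\frac{2\pi}{3}$: (1) $u=\left\{\frac{|x|^3}{9}-\frac{\cos3\theta_1}{9}(x_1^3-3x_1x_2^2)-\frac{\sin3\theta_1}{9}(3x_1^2x_2-x_2^3)\right\}\chi_{\{\theta_1<\theta<\theta_2\}}$; (2) for some $\varsigma\in[0,\frac{2\pi}{3}]$, with $\theta_3:=\theta_2+\varsigma$, $$u=\left\{\frac{|x|^3}{9}-\frac{\cos3\theta_1}{9}(x_1^3-3x_1x_2^2)-\frac{\sin3\theta_1}{9}(3x_1^2x_2-x_2^3)\right\}\chi_{\{\theta_1<\theta<\theta_2\}}+\left\{\frac{|x|^3}{9}-\frac{\cos3\theta_3}{9}(x_1^3-3x_1x_2^2)-\frac{\sin3\theta_3}{9}(3x_1^2x_2-x_2^3)\right\}\chi_{\{\theta_3<\theta<\theta_3+\frac{2\pi}{3}\}};$$ (3) $u=\left\{\frac{|x|^3}{9}-\frac{\cos3\theta_1}{9}(x_1^3-3x_1x_2^2)-\frac{\sin3\theta_1}{9}(3x_1^2x_2-x_2^3)\right\}\left(\chi_{\{\theta_1<\theta<\theta_2\}}+\chi_{\{\theta_2<\theta<\theta_2+\frac{2\pi}{3}\}}+\chi_{\{\theta_2+\frac{2\pi}{3}<\theta<\theta_2+\frac{4\pi}{3}\}}\right)$; (4) $u=\frac{|x|^3}{9}+a(x_1^3-3x_1x_2^2)+b(3x_1^2x_2-x_2^3)$ for some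 constants $a,b\in\mathbb{R}$ with $\sqrt{a^2+b^2}<\frac19$.
   Context: A homogeneous global solution is a function $u\in C^{1,1}_{loc}(\mathbb{R}^2)$ with $u\ge0$, homogeneous of degree $3$, satisfying $\Delta u=|x|\chi_{\{u>0\}}$ in $\mathbb{R}^2$ (in the sense of distributions). $\theta$ denotes the polar angle, and $\{\alpha<\theta<\beta\}$ denotes the open sector of points $re^{i\theta}$, $r>0$, with polar angle (mod $2\pi$) in $(\alpha,\beta)$. *)

(* Defs.v *)
From HB Require Import structures.
From mathcomp Require Import all_boot all_order all_algebra.
From mathcomp Require Import all_classical all_reals all_analysis.
Set Implicit Arguments.
Unset Strict Implicit.
Unset Printing Implicit Defensive.
Import Order.TTheory GRing.Theory Num.Theory.
Import numFieldNormedType.Exports.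
Local Open Scope classical_set_scope.
Local Open Scope ring_scope.

Section Plane.
Variable R : realType.
Implicit Types (f u g phi : R * R -> R) (p q : R * R).

(* The Euclidean norm; [`|p|] on [R * R] is the sup norm. *)
Definition enorm p : R := Num.sqrt (p.1 ^+ 2 + p.2 ^+ 2).

Definition dx1 f p : R := 'D_(1, 0) f p.
Definition dx2 f p : R := 'D_(0, 1) f p.
Definition laplacian f p : R := dx1 (dx1 f) p + dx2 (dx2 f) p.

(* The library's Lipschitz condition uses the sup norm on [R * R]; it is
   equivalent to the Euclidean one. Continuity of the gradient follows from
   the Lipschitz bounds. *)
Definition C11loc u : Prop :=
  (forall p, differentiable u p) /\
  (forall K : set (R * R), compact K ->
     [lipschitz dx1 u p | p in K] /\ [lipschitz dx2 u p | p in K]).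

Fixpoint Cn (n : nat) f : Prop :=
  continuous f /\
  if n is m.+1 then
    [/\ (forall p, derivable f p (1, 0)), (forall p, derivable f p (0, 1)),
        Cn m (dx1 f) & Cn m (dx2 f)]
  else True.

Definition test_function phi : Prop :=
  (forall n, Cn n phi) /\ compact (closure [set p | phi p != 0]).

Definition lebesgue2 := (@lebesgue_measure R \x @lebesgue_measure R)%E.

Definition laplacian_eq_in_distributions u g : Prop :=
  forall phi, test_function phi ->
    (\int[lebesgue2]_p (u p * laplacian phi p)%:E =
     \int[lebesgue2]_p (g p * phi p)%:E)%E.

Definition homogeneous (k : nat) u : Prop :=
  forall (t : R) p, 0 < t -> u (t *: p) = t ^+ k * u p.

Definition homogeneous_global_solution u : Prop :=
  [/\ C11loc u, (forall p, 0 <= u p), homogeneous 3 u &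
      laplacian_eq_in_distributions u
        (fun p => enorm p * \1_[set q | 0 < u q] p)].

(* [t] is any determination of the polar angle, so the angle is taken
   modulo 2 pi. *)
Definition sector (alpha beta : R) : set (R * R) :=
  [set p | exists r t : R,
     [/\ 0 < r, alpha < t < beta & p = (r * cos t, r * sin t)]].

Definition profile (theta : R) p : R :=
  enorm p ^+ 3 / 9
  - cos (3 * theta) / 9 * (p.1 ^+ 3 - 3 * p.1 * p.2 ^+ 2)
  - sin (3 * theta) / 9 * (3 * p.1 ^+ 2 * p.2 - p.2 ^+ 3).

End Plane.

(* Main.v *)
(**
On the unit circle a homogeneous solution is u = r^3 f(theta), where
f >= 0 formally solves f'' + 9 f = 1 on {f > 0}, so there
f = 1/9 + A cos(3 theta) + B sin(3 theta) with constants A and B. At a zero of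
f, u attains its minimum, its gradient vanishes, and A and B are prescribed
there; hence the positivity set of f is either the whole circle or a union of
disjoint arcs of length exactly 2 pi/3, on which f = (1 - cos 3(theta - alpha))/9
with alpha the starting angle. At most three such arcs fit on the circle.

The constancy of A and B is obtained without polar coordinates or elliptic
regularity. On the half-plane s x > 0, s = 1 or -1, one has
u(x, y) = (s x)^3 h(t) with slope t = y/(s x). The distributional equation
tested on a(s x) b(y/(s x)) becomes, by Fubini and integration by parts in x, a
weak second-order equation for h alone. A and B are first integrals of that
equation involving only h and h', so the du Bois-Reymond lemma makes them
constant on slope intervals where h > 0. The directions x = 0 are recovered by
continuity of the gradient.
*)
Require Import Defs.
From HB Require Import structures.
From mathcomp Require Import all_boot all_order all_algebra.
From mathcomp Require Import all_classical all_reals all_analysis.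
From mathcomp Require Import measurable_realfun.
From mathcomp Require Import ring lra.
Import Order.TTheory GRing.Theory Num.Theory.
Import numFieldNormedType.Exports.
Local Open Scope classical_set_scope.
Local Open Scope ring_scope.

Set Implicit Arguments.
Unset Strict Implicit.

(** * Smooth functions of one variable *)

Section Smooth.
Variable R : realType.
Implicit Types f g : R -> R.

(** The slope is preferred to the angle because, for fixed x, y = t (s x) is a one-variable
    dilation, so no planar change of variables is needed. Where h > 0 the equation reads weakly (1 +
    t^2) h'' - 4 t h' + 6 h = sqrt (1 + t^2). Its homogeneous solutions are, up to sign, the traces
    on x = s of the cubic harmonics: 1 - 3 t^2 and 3 t - t^3, the real and imaginary parts of (1 + i
    t)^3. A particular solution is (1 + t^2)^(3/2) / 9, the trace of |x|^3 / 9. A third of the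
    Wronskian of h with one harmonic, weighted by (1 + t^2)^(-2) and corrected by the share of the
    particular solution, is up to sign the coefficient of the other harmonic. It contains h' but not
    h'', which makes it usable for a u that is only C^{1,1}. The factor a lives in [1, 2] to stay
    away from x = 0, where the slope degenerates. The same coefficients can be read off u and its
    gradient at every angle, and are continuous there; this carries the constants of an arc to its
    endpoints, where they are known. *)

Fixpoint Ck (n : nat) f : Prop :=
  if n is m.+1 then (forall x : R, derivable f x 1) /\ Ck m (derive1 f)
  else continuous f.

Definition smooth f : Prop := forall n, Ck n f.

Lemma is_derive_continuous f f' :
  (forall x : R, is_derive x 1 f (f' x)) -> continuous f.
Proof.
move=> df x; apply: differentiable_continuous; apply/derivable1_diffP.
by case: (df x).
Qed.

Lemma derive1_is_derive f f' :
  (forall x : R, is_derive x 1 f (f' x)) -> derive1 f = f'.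
Proof. by move=> df; apply/funext => x; rewrite derive1E derive_val. Qed.

Lemma Ck_is_derive n f f' :
  (forall x : R, is_derive x 1 f (f' x)) -> Ck n f' -> Ck n.+1 f.
Proof.
move=> df kf' /=; split; last by rewrite (derive1_is_derive df).
by move=> x; case: (df x).
Qed.

Lemma derivable1_is_derive f :
  (forall x : R, derivable f x 1) -> forall x : R, is_derive x 1 f (derive1 f x).
Proof. by move=> df x; apply: DeriveDef => //; rewrite derive1E. Qed.

Lemma is_derive_pow f n (x f' : R) : is_derive x 1 f f' ->
  is_derive x 1 (fun y => f y ^+ n) (n%:R * f x ^+ n.-1 * f').
Proof.
move=> df; have -> : (fun y => f y ^+ n) = f ^+ n by rewrite exprfctE.
exact: is_deriveX.
Qed.

Lemma Ck_continuous n f : Ck n f -> continuous f.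
Proof.
case: n => [//|n] [df _].
by apply: (@is_derive_continuous _ (derive1 f)); exact: derivable1_is_derive.
Qed.

Lemma CkW n f : Ck n.+1 f -> Ck n f.
Proof.
elim: n f => [f|n IH f [df kf]]; first exact: Ck_continuous.
by split => //; exact: IH.
Qed.

Lemma Ck_cst n (c : R) : Ck n (fun=> c).
Proof.
elim: n c => [c x|n IH c]; first exact: cvg_cst.
by apply: (@Ck_is_derive _ _ (fun=> 0)).
Qed.

Lemma CkD n f g : Ck n f -> Ck n g -> Ck n (fun x => f x + g x).
Proof.
elim: n f g => [f g cf cg x|n IH f g [df kf] [dg kg]].
  by apply: cvgD; [exact: cf|exact: cg].
apply: (@Ck_is_derive _ _ (fun x => derive1 f x + derive1 g x)); last exact: IH.
move=> x; have := derivable1_is_derive df x; have := derivable1_is_derive dg x.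
by move=> *; exact: is_deriveD.
Qed.

Lemma CkM n f g : Ck n f -> Ck n g -> Ck n (fun x => f x * g x).
Proof.
elim: n f g => [f g cf cg x|n IH f g kf kg].
  by apply: cvgM; [exact: cf|exact: cg].
have [[df kf'] [dg kg']] := (kf, kg).
apply: (@Ck_is_derive _ _ (fun x => f x * derive1 g x + g x * derive1 f x)).
  move=> x; have := derivable1_is_derive df x.
  by have := derivable1_is_derive dg x => *; exact: is_deriveM.
by apply: CkD; apply: IH => //; exact: CkW.
Qed.

Lemma is_derive_affine (a b x : R) : is_derive x 1 (fun x : R => a * x + b) a.
Proof. by apply: is_derive_eq; rewrite addr0 /GRing.scale/= mulr1. Qed.

Lemma Ck_affine n f (a b : R) : Ck n f -> Ck n (fun x => f (a * x + b)).
Proof.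
elim: n f => [f cf x|n IH f [df kf]].
  apply: (@continuous_comp _ _ _ (fun x => a * x + b) f); last exact: cf.
  by apply: cvgD; [apply: cvgM; [exact: cvg_cst|exact: cvg_id]|exact: cvg_cst].
refine (@Ck_is_derive n _ (fun x => a * derive1 f (a * x + b)) _ _).
  move=> x; rewrite mulrC.
  have h1 := is_derive_affine a b x.
  by apply: (@is_derive1_comp _ f (fun x => a * x + b)); exact: derivable1_is_derive.
by apply: CkM; [exact: Ck_cst|exact: IH].
Qed.

Lemma CkV n f : (forall x, f x != 0) -> Ck n f -> Ck n (fun x => (f x)^-1).
Proof.
move=> f0; elim: n => [cf x|n IH kf]; first by apply: cvgV => //; exact: cf.
have [df kf'] := kf.
refine (@Ck_is_derive n _ (fun x => (-1 * derive1 f x) * ((f x)^-1 * (f x)^-1)) _ _).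
  move=> x; have dx := derivable1_is_derive df x.
  apply: (is_derive_eq (is_deriveV (f0 x) dx)).
  by rewrite /GRing.scale/=; field.
have kV := IH (CkW kf).
by apply: CkM; apply: CkM => //; exact: Ck_cst.
Qed.

Lemma smooth_is_derive f : smooth f -> forall x : R, is_derive x 1 f (derive1 f x).
Proof. by move=> sf; apply: derivable1_is_derive; case: (sf 1%N). Qed.

Lemma smooth_continuous f : smooth f -> continuous f.
Proof. exact: (fun sf => sf 0%N). Qed.

Lemma smooth_derive1 f : smooth f -> smooth (derive1 f).
Proof. by move=> sf n; case: (sf n.+1). Qed.

Lemma smooth_cst (c : R) : smooth (fun=> c).
Proof. by move=> n; exact: Ck_cst. Qed.

Lemma smooth_id : smooth (fun x : R => x).
Proof.
case=> [x|n]; first exact: cvg_id.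
by apply: (@Ck_is_derive _ _ (fun=> 1)); exact: Ck_cst.
Qed.

Lemma smoothD f g : smooth f -> smooth g -> smooth (fun x => f x + g x).
Proof. by move=> sf sg n; exact: CkD. Qed.

Lemma smoothM f g : smooth f -> smooth g -> smooth (fun x => f x * g x).
Proof. by move=> sf sg n; exact: CkM. Qed.

Lemma smoothX f n : smooth f -> smooth (fun x => f x ^+ n).
Proof.
move=> sf; elim: n => [|n IH]; first exact: smooth_cst.
by under [X in smooth X]funext do rewrite exprS; exact: smoothM.
Qed.

Lemma smooth_affine f (a b : R) : smooth f -> smooth (fun x => f (a * x + b)).
Proof. by move=> sf n; exact: Ck_affine. Qed.

Lemma smoothV f : (forall x, f x != 0) -> smooth f ->
  smooth (fun x => (f x)^-1).
Proof. by move=> f0 sf n; exact: CkV. Qed.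

(** The functions s^{-k} exp (-1/s), continued by 0. Differentiation maps the family into its own
    linear span, so all orders of smoothness follow by one induction with k free. *)
Definition flat (k : nat) (s : R) : R :=
  if 0 < s then s^-1 ^+ k * expR (- s^-1) else 0.

Lemma flat_ge0 k s : 0 <= flat k s.
Proof.
rewrite /flat; case: ifPn => // s0.
by rewrite mulr_ge0 ?expR_ge0// exprn_ge0// invr_ge0 ltW.
Qed.

Lemma flat_gt0 k s : 0 < s -> 0 < flat k s.
Proof. by move=> s0; rewrite /flat s0 mulr_gt0 ?expR_gt0// exprn_gt0// invr_gt0. Qed.

Lemma flat_le0 k s : s <= 0 -> flat k s = 0.
Proof. by move=> s0; rewrite /flat ltNge s0. Qed.

(** The exponential series gives exp (1/s) >= s^{-(k+2)} / (k+2)!; the two spare powers of s leave a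
    quadratic bound, which forces derivative 0 at the origin. *)
Lemma flat_leX2 k s : flat k s <= (k.+2)`!%:R * s ^+ 2.
Proof.
rewrite /flat; case: ifPn => [s0|_]; last by rewrite mulr_ge0 ?sqr_ge0.
have : 1 + s^-1 ^+ k.+2 / k.+2`!%:R <= expR s^-1.
  by apply: expR_ge1Dxn; rewrite invr_ge0 ltW.
have F0 : 0 < (k.+2)`!%:R :> R by rewrite ltr0n fact_gt0.
move=> h.
have {}h : s^-1 ^+ k.+2 / k.+2`!%:R <= expR s^-1 by lra.
rewrite expRN ler_pdivrMr ?expR_gt0//.
have -> : s^-1 ^+ k = s^-1 ^+ k.+2 / k.+2`!%:R * (k.+2`!%:R * s ^+ 2).
  by rewrite !exprS; field; rewrite !gt_eqF.
by rewrite mulrC ler_wpM2l// mulr_ge0 ?sqr_ge0// ltW.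
Qed.

Lemma is_derive_flat k (s : R) :
  is_derive s 1 (flat k) (- k%:R * flat k.+1 s + flat k.+2 s).
Proof.
have [s0|s0|->] := ltgtP s 0.
- rewrite !flat_le0 ?(ltW s0)// mulr0 addr0.
  apply: (@near_eq_is_derive _ _ _ (fun=> 0)).
  + near=> x; rewrite flat_le0//.
    by near: x; exact: lt_le_nbhsl.
- rewrite /flat s0.
  apply: (@near_eq_is_derive _ _ _ (fun s : R => s^-1 ^+ k * expR (- s^-1))).
  + near=> x; rewrite /flat ifT//.
    by near: x; exact: lt_nbhsr.
  + have sn0 : s != 0 by rewrite gt_eqF.
    have dV : is_derive s 1 (fun x : R => x^-1) (- s ^- 2 *: 1).
      exact: is_deriveV.
    have dE : is_derive s 1 (fun x : R => expR (- x^-1)) (expR (- s^-1) * s ^- 2).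
      apply: (@is_derive1_comp _ expR (fun x : R => - x^-1)).
      apply: is_derive_eq; rewrite /GRing.scale/=; ring.
    apply: (is_derive_eq (is_deriveM (is_derive_pow k dV) dE)).
    rewrite /GRing.scale/=.
    by case: k => [|k] /=; rewrite ?exprS ?expr0; field.
- rewrite !flat_le0// mulr0 addr0.
  apply/is_derive1_caratheodory.
  (* Caratheodory's slope function: division by 0 returns 0, which is also the derivative at the
     origin, so what remains is the limit at 0, where the quotient is at most (k+2)! |z|. *)
  exists (fun z => flat k z / z); split.
  + move=> z; rewrite [flat k 0]flat_le0// !subr0.
    by have [->|z0] := eqVneq z 0; [rewrite flat_le0// mulr0|rewrite divfK].
  + suff C0 : (flat k z / z @[z --> (0 : R)] --> (0 : R)).
      have z0 : flat k 0 / 0 = 0 :> R by rewrite flat_le0// mul0r.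
      by move: C0; rewrite -[X in _ --> X]z0.
    have C0 : 0 < k.+2`!%:R :> R by rewrite ltr0n fact_gt0.
    suff C1 (e : R) : 0 < e -> \forall z \near (0 : R), `|flat k z / z| < e.
      exact/cvgr0Pnorm_lt.
    move=> e0; have d0 : 0 < e / k.+2`!%:R by rewrite divr_gt0.
    near=> z.
    have zs : `|z| < e / k.+2`!%:R.
      near: z.
      exact: (@nbhs0_lt R R^o _ d0).
    rewrite normrM normfV ger0_norm ?flat_ge0//.
    have [->|z0] := eqVneq z 0; first by rewrite normr0 invr0 mulr0.
    rewrite ltr_pdivrMr ?normr_gt0// (le_lt_trans (flat_leX2 k z))//.
    rewrite -real_normK ?num_real// expr2 mulrA ltr_pM2r ?normr_gt0//.
    by rewrite mulrC -ltr_pdivlMr.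
  + by rewrite flat_le0// mul0r.
Unshelve. all: by end_near. Qed.

Lemma smooth_flat k : smooth (flat k).
Proof.
move=> n; elim: n k => [|n IH] k.
  exact: (is_derive_continuous (is_derive_flat k)).
apply: (Ck_is_derive (is_derive_flat k)).
by apply: CkD => //; apply: CkM => //; exact: Ck_cst.
Qed.

End Smooth.

(** * The du Bois-Reymond lemma *)

Section Bumps.
Variable R : realType.
Implicit Types (f F M : R -> R) (a b c d s x : R).
Local Notation mu := (@lebesgue_measure R).

Lemma continuous_Rintegrable f (a b : R) :
  continuous f -> mu.-integrable `[a, b] (EFin \o f).
Proof.
move=> cf; apply: continuous_compact_integrable; first exact: segment_compact.
exact: continuous_subspaceT.
Qed.

Lemma Rintegral_is_derive F f (a b : R) : a < b ->
  (forall x : R, is_derive x 1 F (f x)) -> continuous f ->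
  \int[mu]_(x in `[a, b]) f x = F b - F a.
Proof.
move=> ab dF cf; have cF := is_derive_continuous dF.
rewrite /Rintegral (@continuous_FTC2 _ f F)//.
- exact: continuous_subspaceT.
- split; first by move=> x _; case: (dF x).
    by apply: cvg_at_right_filter; exact: cF.
  by apply: cvg_at_left_filter; exact: cF.
- by move=> x _; rewrite (derive1_is_derive dF).
Qed.

(** The usual smooth transition from 0 to 1 across [0, 1]. The argument [-1 * s + 1] has the shape
    expected by [smooth_affine]. *)
Definition step (s : R) : R :=
  flat 0 s * (flat 0 s + flat 0 (-1 * s + 1))^-1.

Definition dstep (s : R) : R :=
  (flat 2 s * flat 0 (-1 * s + 1) + flat 0 s * flat 2 (-1 * s + 1)) *
  ((flat 0 s + flat 0 (-1 * s + 1))^-1 * (flat 0 s + flat 0 (-1 * s + 1))^-1).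

Lemma step_den_gt0 s : 0 < flat 0 s + flat 0 (-1 * s + 1).
Proof.
have [s0|s0] := ltP 0 s.
  by rewrite ltr_wpDr ?flat_ge0 ?flat_gt0.
by rewrite ltr_wpDl ?flat_ge0 ?flat_gt0//; lra.
Qed.

Lemma smooth_step : smooth step.
Proof.
apply: smoothM; first exact: smooth_flat.
apply: smoothV => [s|]; first by rewrite gt_eqF// step_den_gt0.
by apply: smoothD; [|apply: smooth_affine]; exact: smooth_flat.
Qed.

Lemma step_le0 s : s <= 0 -> step s = 0.
Proof. by move=> s0; rewrite /step flat_le0// mul0r. Qed.

Lemma step_ge1 s : 1 <= s -> step s = 1.
Proof.
move=> s1; rewrite /step [flat 0 (_ + 1)]flat_le0; last lra.
by rewrite addr0 divff// gt_eqF// flat_gt0//; lra.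
Qed.

Lemma is_derive_step s : is_derive s 1 step (dstep s).
Proof.
have d0 : is_derive s 1 (flat 0) (flat 2 s).
  by apply: (is_derive_eq (is_derive_flat 0 s)); rewrite mulNr mul0r oppr0 add0r.
have dl := is_derive_affine (-1) 1 s.
have d1 : is_derive s 1 (fun s : R => flat 0 (-1 * s + 1))
    (- flat 2 (-1 * s + 1)).
  apply: (is_derive_eq (@is_derive1_comp _ (flat 0) (fun s : R => -1 * s + 1) s
    _ _ (is_derive_flat 0 _) dl)).
  by rewrite mulNr mul0r oppr0 add0r mulrN1.
have d2 := is_deriveD d0 d1.
have n0 : (flat (R := R) 0 + (fun s : R => flat 0 (-1 * s + 1))) s != 0.
  by rewrite gt_eqF// step_den_gt0.
apply: (is_derive_eq (is_deriveM d0 (is_deriveV n0 d2))).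
rewrite /GRing.scale/= /dstep; move: n0 => /= n0.
have -> : (flat (R := R) 0 + (fun s : R => flat 0 (-1 * s + 1))) s =
  flat 0 s + flat 0 (-1 * s + 1) by [].
by field; rewrite gt_eqF// step_den_gt0.
Qed.

Lemma dstep_ge0 s : 0 <= dstep s.
Proof.
apply: mulr_ge0; last by rewrite mulr_ge0// invr_ge0 ltW// step_den_gt0.
by rewrite addr_ge0// mulr_ge0// flat_ge0.
Qed.

Lemma dstep_eq0 s : ~~ (0 < s < 1) -> dstep s = 0.
Proof.
rewrite negb_and -!leNgt => /orP[s0|s1]; rewrite /dstep.
  by rewrite !(flat_le0 _ s0) !mul0r addr0 mul0r.
by rewrite !(@flat_le0 _ _ (-1 * s + 1)) ?mulr0 ?addr0 ?mul0r//; lra.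
Qed.

Lemma smooth_step_at (s e : R) : 0 < e -> exists T : R -> R,
  [/\ smooth T, forall x, x <= s -> T x = 0, forall x, s + e <= x -> T x = 1,
      forall x, 0 <= derive1 T x
    & forall x, ~~ (s < x < s + e) -> derive1 T x = 0].
Proof.
move=> e0; have e'0 : 0 < e^-1 by rewrite invr_gt0.
have E x : e^-1 * x + - (s / e) = (x - s) / e by ring.
have dT (x : R) : is_derive x 1 (fun x => step (e^-1 * x + - (s / e)))
    (dstep (e^-1 * x + - (s / e)) * e^-1).
  apply: (@is_derive1_comp _ step (fun x : R => e^-1 * x + - (s / e))).
    exact: is_derive_step.
  exact: is_derive_affine.
exists (fun x => step (e^-1 * x + - (s / e))); split.
- by apply: smooth_affine; exact: smooth_step.
- by move=> x xs; rewrite step_le0// E pmulr_lle0// subr_le0.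
- by move=> x xs; rewrite step_ge1// E ler_pdivlMr//; lra.
- by move=> x; rewrite (derive1_is_derive dT) mulr_ge0 ?dstep_ge0// ltW.
- move=> x xs; rewrite (derive1_is_derive dT) dstep_eq0 ?mul0r//.
  rewrite E; apply: contra xs.
  by rewrite ltr_pdivrMr// ltr_pdivlMr// => /andP[]; lra.
Qed.

(** Tested against a plateau that rises just after s and falls just after s', the hypothesis
    compares averages of M near these two points; were M s' larger, the integral would be negative.
    The reverse inequality will come from -M, so M need not be regularized. *)
Lemma du_bois_reymond_le M (c d s s' : R) : continuous M ->
  (forall (b : R -> R) c' d', c < c' -> d' < d -> smooth b ->
    (forall x, ~~ (c' <= x <= d') -> b x = 0) ->
    \int[mu]_(x in `[c, d]) (M x * derive1 b x) = 0) ->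
  c < s -> s < s' -> s' < d -> M s' <= M s.
Proof.
move=> cM M0 cs ss' s'd; rewrite leNgt; apply/negP => Mlt.
(* A third of the gap: M stays below M s + g where [b] rises and above M s' - g where it falls, so
   the integral is at most -g. *)
pose g := (M s' - M s) / 3.
have g0 : 0 < g by rewrite divr_gt0// subr_gt0.
have [e1 /= e10 He1] : \forall x \near s, `|M s - M x| < g.
  by have /cvgrPdist_lt := cM s; apply.
have [e2 /= e20 He2] : \forall x \near s', `|M s' - M x| < g.
  by have /cvgrPdist_lt := cM s'; apply.
pose e := Num.min (Num.min e1 e2) (d - s') / 2.
have m0 : 0 < Num.min (Num.min e1 e2) (d - s').
  by rewrite !lt_min e10 e20 subr_gt0.
have [ee1 ee2 ed] : [/\ e < e1, e < e2 & e < d - s'].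
  have : e < Num.min (Num.min e1 e2) (d - s') by rewrite /e; lra.
  by rewrite !lt_min => /andP[/andP[]].
have e0 : 0 < e by rewrite divr_gt0.
have [T [sT T0 T1 dT0 dT1]] := smooth_step_at s e0.
have [T' [sT' T'0 T'1 dT'0 dT'1]] := smooth_step_at s' e0.
pose b x := T x + -1 * T' x.
have sb : smooth b by apply: smoothD => //; apply: smoothM => //; exact: smooth_cst.
have db (x : R) : is_derive x 1 b (derive1 T x - derive1 T' x).
  have dTx := smooth_is_derive sT x; have dT'x := smooth_is_derive sT' x.
  have -> : b = T - T' by apply/funext => y; rewrite /b mulN1r.
  exact: is_deriveB.
have b0 x : ~~ (s <= x <= s' + e) -> b x = 0.
  rewrite negb_and -!ltNge /b => /orP[xc|dx].
    by rewrite T0 ?T'0 ?mulr0 ?addr0//; lra.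
  by rewrite T1 ?T'1; lra.
have cd : c < d by lra.
have cD : continuous (derive1 b) by exact/smooth_continuous/smooth_derive1.
have cDT : continuous (derive1 T) by exact/smooth_continuous/smooth_derive1.
have cDT' : continuous (derive1 T') by exact/smooth_continuous/smooth_derive1.
have se : s' + e < d by lra.
have := M0 b _ _ cs se sb b0; apply/eqP; rewrite lt_eqF//.
pose m1 := M s + g; pose m2 := M s' - g.
have dF (x : R) : is_derive x 1 (fun x => m1 * T x - m2 * T' x)
    (m1 * derive1 T x - m2 * derive1 T' x).
  have dTx := smooth_is_derive sT x; have dT'x := smooth_is_derive sT' x.
  by apply: (@is_deriveB _ _ _ (m1 *: T) (m2 *: T')); exact: is_deriveZ.
have cf : continuous (fun x => m1 * derive1 T x - m2 * derive1 T' x).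
  move=> x; apply: cvgB; apply: cvgM; try exact: cvg_cst.
    exact: cDT.
  exact: cDT'.
apply: (@le_lt_trans _ _ (\int[mu]_(x in `[c, d])
    (m1 * derive1 T x - m2 * derive1 T' x))).
  apply: le_Rintegral => //.
  - by apply: continuous_Rintegrable => x; apply: cvgM; [exact: cM|exact: cD].
  - exact: continuous_Rintegrable.
  - move=> x _; rewrite (derive1_is_derive db) mulrBr lerB//.
      have [xs|xs] := boolP (s < x < s + e); last by rewrite dT1// !mulr0.
      rewrite ler_wpM2r// /m1.
      have : `|M s - M x| < g by apply: He1; rewrite /= ltr_norml; lra.
      by rewrite ltr_norml; lra.
    have [xs|xs] := boolP (s' < x < s' + e); last by rewrite dT'1// !mulr0.
    rewrite ler_wpM2r// /m2.
    have : `|M s' - M x| < g by apply: He2; rewrite /= ltr_norml; lra.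
    by rewrite ltr_norml; lra.
rewrite (Rintegral_is_derive cd dF cf) (T1 d) ?(T'1 d) ?(T0 c) ?(T'0 c); try lra.
by rewrite /m1 /m2 /g; lra.
Qed.

Lemma du_bois_reymond M (c d : R) : continuous M ->
  (forall (b : R -> R) c' d', c < c' -> d' < d -> smooth b ->
    (forall x, ~~ (c' <= x <= d') -> b x = 0) ->
    \int[mu]_(x in `[c, d]) (M x * derive1 b x) = 0) ->
  forall s s', c < s < d -> c < s' < d -> M s = M s'.
Proof.
move=> cM M0; suff H s s' : c < s -> s < s' -> s' < d -> M s = M s'.
  move=> s s' /andP[cs sd] /andP[cs' s'd].
  by have [ss'|ss'|->//] := ltgtP s s'; [|symmetry]; exact: H.
move=> cs ss' s'd; apply/eqP; rewrite eq_le (du_bois_reymond_le cM M0 cs ss' s'd) andbT.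
rewrite -lerN2; apply: (@du_bois_reymond_le (fun x => - M x) c d) => //.
  by move=> x; apply: cvgN; exact: cM.
move=> b c' d' cc' dd' sb b0; rewrite -oppr0 -(M0 b c' d' cc' dd' sb b0) -mulN1r.
rewrite -RintegralZl//; first by apply: eq_Rintegral => x _; rewrite mulN1r mulNr.
apply: continuous_Rintegrable => x; apply: cvgM; first exact: cM.
exact/smooth_continuous/smooth_derive1.
Qed.

End Bumps.

(** * Integration in slope coordinates *)

Section Charts.
Variable R : realType.
Implicit Types (f g a b : R -> R) (c d s x t : R) (p : R * R).
Local Notation mu := (@lebesgue_measure R).

Lemma integral_csupp f c d : continuous f ->
  (forall x, ~~ (c <= x <= d) -> f x = 0) ->
  (\int[mu]_x (f x)%:E = (\int[mu]_(x in `[c, d]) f x)%:E)%E.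
Proof.
move=> cf f0.
rewrite /Rintegral fineK; last first.
  by apply: integrable_fin_num => //; exact: continuous_Rintegrable.
rewrite [RHS]integral_mkcond; apply: eq_integral => x _.
rewrite patchE; case: ifPn => // xcd; rewrite f0//.
by apply: contra xcd => xcd; rewrite inE/= in_itv.
Qed.

(* A smooth substitute for [1 / x], equal to it for [x > 1 / 2], so that products
   with functions supported in [1, 2] need no case analysis at [x = 0]. *)
Definition kap x : R := (x + step (-2 * x + 1) * (-1 * x + 1))^-1.

Lemma kapE x : 1 / 2 < x -> kap x = x^-1.
Proof. by move=> x1; rewrite /kap step_le0 ?mul0r ?addr0//; lra. Qed.

Lemma step_ge0 x : 0 <= step x.
Proof. by rewrite mulr_ge0 ?flat_ge0// invr_ge0 ltW// step_den_gt0. Qed.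

Lemma smooth_kap : smooth kap.
Proof.
apply: smoothV => [x|].
  have [x1|x1] := ltP (1 / 2) x.
    by rewrite step_le0 ?mul0r ?addr0 ?gt_eqF//; lra.
  have [x0|x0] := leP x 0.
    by rewrite step_ge1 ?mul1r ?gt_eqF//; lra.
  by rewrite gt_eqF// ltr_pwDl// mulr_ge0 ?step_ge0//; lra.
apply: smoothD; first exact: smooth_id.
apply: smoothM; first by apply: smooth_affine; exact: smooth_step.
by apply: (@smooth_affine _ (fun x => x)); exact: smooth_id.
Qed.

Lemma is_derive_kap x : 1 / 2 < x -> is_derive x 1 kap (- x ^- 2).
Proof.
move=> x1; apply: (@near_eq_is_derive _ _ _ (fun x : R => x^-1)).
  by near=> y; rewrite kapE//; near: y; exact: lt_nbhsr.
have x0 : x != 0 by rewrite gt_eqF//; lra.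
by apply: (is_derive_eq (is_deriveV x0 (is_derive_id x 1))); rewrite /GRing.scale/= mulr1.
Unshelve. all: by end_near. Qed.

(* The function [a (s x) * b (y / (s x))] when [a] is supported in [1, 2]. *)
Definition chart s a b p : R := a (s * p.1) * b (p.2 * kap (s * p.1)).

Lemma continuous_chart s a b : continuous a -> continuous b ->
  continuous (chart s a b).
Proof.
move=> ca cb p.
have c1 (f : R -> R) : continuous f -> f (s * q.1) @[q --> p] --> f (s * p.1).
  move=> cf; apply: (@continuous_comp _ _ _ (fun q : R * R => s * q.1) f);
    last exact: cf.
  by apply: cvgM; [exact: cvg_cst|exact: cvg_fst].
apply: cvgM; first exact: c1.
apply: (@continuous_comp _ _ _ (fun q : R * R => q.2 * kap (s * q.1)) b);
  last exact: cb.
apply: cvgM; first exact: cvg_snd.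
by apply: c1; exact/smooth_continuous/smooth_kap.
Qed.

Lemma measurable_chart s a b : continuous a -> continuous b ->
  measurable_fun setT (chart s a b).
Proof.
move=> ca cb.
have cs (f : R -> R) : continuous f -> measurable_fun setT (fun p => f (s * p.1)).
  move=> cf; apply: (measurableT_comp (f := f)).
    exact: continuous_measurable_fun.
  by apply: measurable_funM => //; exact: measurable_fst.
apply: measurable_funM; first exact: cs.
apply: (measurableT_comp (f := b)); first exact: continuous_measurable_fun.
apply: measurable_funM; first exact: measurable_snd.
by apply: cs; exact/smooth_continuous/smooth_kap.
Qed.

Lemma integral_dilation f c d (k : R) : c <= d -> 0 < k -> continuous f ->
  (forall x, ~~ (c <= x <= d) -> f x = 0) ->
  (\int[mu]_y (f (y / k))%:E = (k * \int[mu]_(x in `[c, d]) f x)%:E)%E.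
Proof.
move=> cd k0 cf f0.
have k0' : k != 0 by rewrite gt_eqF.
have cfk : continuous (fun y : R => f (y / k)).
  move=> y; apply: (@continuous_comp _ _ _ (fun y : R => y / k) f); last exact: cf.
  by apply: cvgM; [exact: cvg_id|exact: cvg_cst].
rewrite (@integral_csupp (fun y => f (y / k)) (k * c) (k * d))//; last first.
  move=> x xk; rewrite f0//; apply: contra xk.
  by rewrite ler_pdivlMr// ler_pdivrMr// ![_ * k]mulrC.
have dF (x : R) : is_derive x 1 (fun x => k * x) k.
  by apply: (is_derive_eq (is_deriveZ k (is_derive_id x (1 : R)))); rewrite /GRing.scale/= mulr1.
have dFE := derive1_is_derive dF.
congr EFin; rewrite -RintegralZl//; last exact: continuous_Rintegrable.
rewrite /Rintegral; congr fine.
rewrite (@integration_by_substitution_increasing _ (fun x => k * x) (fun y => f (y / k)) c d)//.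
- apply: eq_integral => x _; rewrite dFE/= mulrC.
  by congr (k * f _)%:E; field.
- by move=> x y _ _; rewrite ltr_pM2l.
- by rewrite dFE => x _; exact: cvg_cst.
- by rewrite dFE; exact: is_cvg_cst.
- by rewrite dFE; exact: is_cvg_cst.
- have ck := is_derive_continuous dF.
  split; first by move=> x _; case: (dF x).
    by apply: cvg_at_right_filter; exact: ck.
  by apply: cvg_at_left_filter; exact: ck.
- exact: continuous_subspaceT.
Qed.

(** On the vertical line through x the substitution y = t (s x) has Jacobian s x, so the slice
    separates into a factor in x and an integral in t. When s x is outside [1, 2] both sides
    vanish. *)
Lemma integral_chart_slice s a b c d x : c <= d -> continuous b ->
  (forall x, ~~ (1 <= x <= 2) -> a x = 0) ->
  (forall x, ~~ (c <= x <= d) -> b x = 0) ->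
  (\int[mu]_y (chart s a b (x, y))%:E =
   (s * x * a (s * x) * \int[mu]_(t in `[c, d]) b t)%:E)%E.
Proof.
move=> cd cb a0 b0; rewrite /chart /=.
have [/andP[x1 x2]|nx] := boolP (1 <= s * x <= 2); last first.
  by rewrite a0// mulr0 mul0r; apply: integral0_eq => y _; rewrite mul0r.
have k0 : 0 < s * x by lra.
rewrite kapE; last lra.
rewrite (@integral_dilation (fun t => a (s * x) * b t) c d (s * x))//.
- by rewrite RintegralZl ?mulrA//; exact: continuous_Rintegrable.
- by move=> y; apply: cvgM; [exact: cvg_cst|exact: cb].
- by move=> y y0; rewrite b0// mulr0.
Qed.

Lemma chart_norm s a b p : `|chart s a b p| =
  chart s (fun x => `|a x|) (fun x => `|b x|) p.
Proof. by rewrite /chart normrM. Qed.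

Lemma continuous_normr f : continuous f -> continuous (fun x : R => `|f x|).
Proof.
by move=> cf x; apply: cvg_norm; exact: cf.
Qed.

Lemma chart_integral s a b c d : `|s| = 1 -> c <= d ->
  continuous a -> continuous b ->
  (forall x, ~~ (1 <= x <= 2) -> a x = 0) ->
  (forall x, ~~ (c <= x <= d) -> b x = 0) ->
  (mu \x mu)%E.-integrable setT (EFin \o chart s a b) /\
  (\int[(mu \x mu)%E]_p (chart s a b p)%:E =
   (\int[mu]_(x in `[(-3), 3]) (s * x * a (s * x)) *
    \int[mu]_(t in `[c, d]) b t)%:E)%E.
Proof.
move=> s1 cd ca cb a0 b0.
have cout (f : R -> R) (k : R) : continuous f ->
    continuous (fun x : R => s * x * f (s * x) * k).
  move=> cf x; apply: cvgM; last exact: cvg_cst.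
  have c1 : s * y @[y --> x] --> s * x.
    by apply: cvgM; [exact: cvg_cst|exact: cvg_id].
  apply: cvgM => //.
  by apply: (@continuous_comp _ _ _ (fun y : R => s * y) f) => //; exact: cf.
have out0 (f : R -> R) (k x : R) : (forall x, ~~ (1 <= x <= 2) -> f x = 0) ->
    ~~ (-3 <= x <= 3) -> s * x * f (s * x) * k = 0.
  move=> f0 x2; rewrite f0 ?mulr0 ?mul0r//. apply: contra x2. move=> /andP[h1 h2].
  have nx : `|x| = `|s * x| by rewrite normrM s1 mul1r.
  by rewrite -ler_norml nx ler_norml; lra.
have int : (mu \x mu)%E.-integrable setT (EFin \o chart s a b).
  apply/integrable12ltyP.
    by apply/measurable_EFinP; exact: measurable_chart.
  under eq_integral => x _.
    under eq_integral => y _ do rewrite /= chart_norm.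
    rewrite (@integral_chart_slice _ _ _ c d) //; first over.
    - exact: continuous_normr.
    - by move=> z z0; rewrite a0// normr0.
    - by move=> z z0; rewrite b0// normr0.
  rewrite (@integral_csupp _ (-3) 3) ?ltry//.
    by apply: (cout (fun x => `|a x|)); exact: continuous_normr.
  by move=> x; apply: (out0 (fun x => `|a x|)) => z z0; rewrite a0// normr0.
split=> //.
rewrite -(integral12_prod_meas1 int) /fubini_F.
under eq_integral => x _ do rewrite /= (@integral_chart_slice _ _ _ c d)//.
rewrite (@integral_csupp _ (-3) 3) //; first last.
- by move=> x; exact: out0.
- exact: cout.
congr EFin; rewrite RintegralZr//.
apply: continuous_Rintegrable => x; have := cout a 1 ca x.
by under eq_fun do rewrite mulr1.
Qed.

End Charts.

(** * Product test functions in s x and the slope *)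

Section TestFunctions.
Variable R : realType.
Implicit Types (f g a b h : R -> R) (c d s x t : R) (p : R * R) (F G : R * R -> R).
Local Notation mu := (@lebesgue_measure R).

Definition smooth_on c d f :=
  smooth f /\ forall x, ~~ (c <= x <= d) -> f x = 0.

Lemma smooth_on_derive1 c d f : smooth_on c d f -> smooth_on c d (derive1 f).
Proof.
move=> [sf f0]; split=> [|x xcd]; first exact: smooth_derive1.
have : \forall y \near x, 0 = f y.
  move: xcd; rewrite negb_and -!ltNge => /orP[xc|dx].
    near=> y; rewrite f0// negb_and -!ltNge; apply/orP; left.
    by near: y; exact: lt_nbhsl.
  near=> y; rewrite f0// negb_and -!ltNge; apply/orP; right.
  by near: y; exact: lt_nbhsr.
move=> e; rewrite derive1E.
by have [_ ->] := near_eq_is_derive e (is_derive_cst (0 : R) x (1 : R)).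
Unshelve. all: by end_near. Qed.

Lemma smooth_onMl c d f g : smooth g -> smooth_on c d f ->
  smooth_on c d (fun x => g x * f x).
Proof.
move=> sg [sf f0]; split; first exact: smoothM.
by move=> x x0; rewrite f0// mulr0.
Qed.

Lemma is_derive_fst F p e :
  is_derive p (1, 0) F e <-> is_derive p.1 1 (fun x : R => F (x, p.2)) e.
Proof.
have E : (fun h : R => h^-1 *: (F (h *: ((1, 0) : R * R) + p) - F p)) =
  (fun h : R => h^-1 *: (F (h *: (1 : R) + p.1, p.2) - F (p.1, p.2))).
  apply/funext => h; congr (_ *: (F _ - F _)); last by case: p.
  by case: p => x y; congr pair; rewrite /= /GRing.scale/= mulr0 add0r.
split=> -[d1 d2]; apply: DeriveDef;
  by [move: d1; rewrite /derivable/= E | move: d2; rewrite /derive/= E].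
Qed.

Lemma is_derive_snd F p e :
  is_derive p (0, 1) F e <-> is_derive p.2 1 (fun y : R => F (p.1, y)) e.
Proof.
have E : (fun h : R => h^-1 *: (F (h *: ((0, 1) : R * R) + p) - F p)) =
  (fun h : R => h^-1 *: (F (p.1, h *: (1 : R) + p.2) - F (p.1, p.2))).
  apply/funext => h; congr (_ *: (F _ - F _)); last by case: p.
  by case: p => x y; congr pair; rewrite /= /GRing.scale/= mulr0 add0r.
split=> -[d1 d2]; apply: DeriveDef;
  by [move: d1; rewrite /derivable/= E | move: d2; rewrite /derive/= E].
Qed.

(** The slope t = y / (s x) has x-derivative -s t / (s x), so the derivative of a chart is a sum of
    charts with new smooth factors. The same happens in y; this closure yields differentiability of
    all orders by induction. *)
Lemma is_derive_chart_fst s a b c d p : smooth_on 1 2 a -> smooth_on c d b ->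
  is_derive p (1, 0) (chart s a b)
   (chart s (fun x => s * derive1 a x) b p +
    chart s (fun x => - s * kap x * a x) (fun t => t * derive1 b t) p).
Proof.
move=> sa sb; apply/is_derive_fst; case: p => x y /=.
have da := smooth_is_derive sa.1; have db := smooth_is_derive sb.1.
have dk := smooth_is_derive (@smooth_kap R).
have dl (z : R) : is_derive z 1 (fun x => s * x) s.
  by apply: (is_derive_eq (is_deriveZ s (is_derive_id z (1 : R)))); rewrite /GRing.scale/= mulr1.
have das := @is_derive1_comp _ a (fun x => s * x) x _ _ (da _) (dl x).
have dks := @is_derive1_comp _ (@kap R) (fun x => s * x) x _ _ (dk _) (dl x).
have dyk : is_derive x 1 (fun x => y * kap (s * x)) (y * (derive1 (@kap R) (s * x) * s)).
  exact: (is_deriveZ y dks).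
have dbs := @is_derive1_comp _ b (fun x => y * kap (s * x)) x _ _ (db _) dyk.
apply: (is_derive_eq (is_deriveM das dbs)).
rewrite /chart /GRing.scale/=.
have [x1|x1] := boolP (1 <= s * x <= 2); last first.
  by rewrite (smooth_on_derive1 sa).2// sa.2// !(mulr0, mul0r, addr0).
have x2 : 1 / 2 < s * x by lra.
have [_] := is_derive_kap x2; rewrite -derive1E => ->.
rewrite kapE//; move: (s * x) x1 x2 => z z12 z1.
by field; rewrite gt_eqF//; lra.
Qed.

Lemma is_derive_chart_snd s a b c d p : smooth_on 1 2 a -> smooth_on c d b ->
  is_derive p (0, 1) (chart s a b)
   (chart s (fun x => kap x * a x) (derive1 b) p).
Proof.
move=> sa sb; apply/is_derive_snd; case: p => x y /=.
have db := smooth_is_derive sb.1.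
have dl : is_derive y 1 (fun y => y * kap (s * x)) (kap (s * x)).
  have -> : (fun y => y * kap (s * x)) = kap (s * x) *: id.
    by apply/funext => z; rewrite mulrC.
  by apply: (is_derive_eq (is_deriveZ _ (is_derive_id y (1 : R)))); rewrite /GRing.scale/= mulr1.
have dbs := @is_derive1_comp _ b (fun y => y * kap (s * x)) y _ _ (db _) dl.
apply: (is_derive_eq (is_deriveZ (a (s * x)) dbs)).
by rewrite /chart /GRing.scale/=; ring.
Qed.

Lemma dx1_chart s a b c d : smooth_on 1 2 a -> smooth_on c d b ->
  dx1 (chart s a b) = fun p =>
    chart s (fun x => s * derive1 a x) b p +
    chart s (fun x => - s * kap x * a x) (fun t => t * derive1 b t) p.
Proof.
by move=> sa sb; apply/funext => p; have [_] := is_derive_chart_fst s p sa sb.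
Qed.

Lemma dx2_chart s a b c d : smooth_on 1 2 a -> smooth_on c d b ->
  dx2 (chart s a b) = chart s (fun x => kap x * a x) (derive1 b).
Proof.
by move=> sa sb; apply/funext => p; have [_] := is_derive_chart_snd s p sa sb.
Qed.

Lemma dx1D F G : (forall p, derivable F p (1, 0)) ->
  (forall p, derivable G p (1, 0)) ->
  dx1 (fun p => F p + G p) = fun p => dx1 F p + dx1 G p.
Proof. by move=> dF dG; apply/funext => p; rewrite /dx1 (deriveD (dF p)). Qed.

Lemma dx2D F G : (forall p, derivable F p (0, 1)) ->
  (forall p, derivable G p (0, 1)) ->
  dx2 (fun p => F p + G p) = fun p => dx2 F p + dx2 G p.
Proof. by move=> dF dG; apply/funext => p; rewrite /dx2 (deriveD (dF p)). Qed.

Lemma CnD n F G : Cn n F -> Cn n G -> Cn n (fun p => F p + G p).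
Proof.
elim: n F G => [F G [cF _] [cG _]|n IH F G].
  by split => // p; apply: cvgD; [exact: cF|exact: cG].
move=> [cF [F1 F2 F1n F2n]] [cG [G1 G2 G1n G2n]]; split.
  by move=> p; apply: cvgD; [exact: cF|exact: cG].
split; [by move=> p; exact: derivableD|by move=> p; exact: derivableD| |].
  by rewrite dx1D//; exact: IH.
by rewrite dx2D//; exact: IH.
Qed.

Lemma Cn_chart n s a b c d : smooth_on 1 2 a -> smooth_on c d b ->
  Cn n (chart s a b).
Proof.
elim: n a b => [|n IH] a b sa sb; have cc : continuous (chart s a b)
  by apply: continuous_chart; apply: smooth_continuous; [case: sa|case: sb].
  by [].
split => //; split.
- by move=> p; have [] := is_derive_chart_fst s p sa sb.
- by move=> p; have [] := is_derive_chart_snd s p sa sb.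
- rewrite (dx1_chart _ sa sb); apply: CnD; apply: IH => //.
  + by apply: smooth_onMl; [exact: smooth_cst|exact: smooth_on_derive1].
  + apply: (@smooth_onMl _ _ a) => //; apply: smoothM; first exact: smooth_cst.
    exact: smooth_kap.
  + by apply: smooth_onMl; [exact: smooth_id|exact: smooth_on_derive1].
- rewrite (dx2_chart _ sa sb); apply: IH; last exact: smooth_on_derive1.
  by apply: smooth_onMl => //; exact: smooth_kap.
Qed.

Lemma test_function_chart s a b c d : `|s| = 1 ->
  smooth_on 1 2 a -> smooth_on c d b -> test_function (chart s a b).
Proof.
move=> s1 sa sb; split; first by move=> n; exact: Cn_chart sa sb.
(* On the support 1 <= s x <= 2 and y = t (s x) with t in [c, d], hence |y| <= 2 max (|c|, |d|). *)
pose M := 2 * Num.max `|c| `|d|.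
pose K := `[(-2 : R), 2]%classic `*` `[- M, M]%classic.
have cK : compact K by apply: compact_setX; exact: segment_compact.
apply: (subclosed_compact _ cK); first exact: closed_closure.
have clK : closed K by apply: compact_closed => //; exact: norm_hausdorff.
rewrite [X in _ `<=` X](_ : K = closure K); last exact/closure_id.
apply: closure_subset.
move=> [x y] /=; rewrite /chart/= mulf_eq0 negb_or => /andP[ax bx].
have /andP[x1 x2] : 1 <= s * x <= 2.
  by apply: contraNT ax => /sa.2 ->.
have /andP[y1 y2] : c <= y * kap (s * x) <= d.
  by apply: contraNT bx => /sb.2 ->.
move: y1 y2; rewrite kapE; last lra.
have k0 : 0 < s * x by lra.
rewrite ler_pdivlMr// ler_pdivrMr// => y1 y2.
have nx : `|x| = s * x.
  by rewrite -(gtr0_norm k0) normrM s1 mul1r.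
split => /=; first by rewrite in_itv/= -ler_norml nx.
rewrite in_itv/= -ler_norml /M.
have cM : `|c| <= Num.max `|c| `|d| by rewrite le_max lexx.
have dM : `|d| <= Num.max `|c| `|d| by rewrite le_max lexx orbT.
set m := Num.max _ _ in cM dM *.
move: cM dM; rewrite !ler_norml => /andP[c1 c2] /andP[d1 d2].
by apply/andP; split; nra.
Qed.

End TestFunctions.

(** * The equation in slope coordinates *)

Section WeakEquation.
Variable R : realType.
Implicit Types (f g a b h : R -> R) (c d s x t : R) (p : R * R) (u : R * R -> R).
Local Notation mu := (@lebesgue_measure R).

Lemma smooth_on_eq0 c d f x : smooth_on c d f -> ~~ (c <= x <= d) -> f x = 0.
Proof. by case=> _; apply. Qed.

Lemma smooth_onZ c d f (k : R) : smooth_on c d f -> smooth_on c d (fun x => k * f x).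
Proof. by apply: smooth_onMl; exact: smooth_cst. Qed.

Lemma homogeneous_slope u n s x y : s * s = 1 -> homogeneous n u ->
  0 < s * x -> u (x, y) = (s * x) ^+ n * u (s, y / (s * x)).
Proof.
move=> ss hu sx0; rewrite -hu//; congr u; congr pair; rewrite /= /GRing.scale/=.
  by rewrite mulrAC ss mul1r.
by rewrite mulrC divfK// gt_eqF.
Qed.

(** Terms are grouped by their slope factor, so that after multiplication by u = (s x)^3 h(t) every
    group is again a chart and its integral factors. The plain inverses of x are harmless since a
    vanishes off [1, 2]. *)
Lemma laplacian_chart s a b c d p : s * s = 1 ->
  smooth_on 1 2 a -> smooth_on c d b ->
  laplacian (chart s a b) p =
  chart s (fun x => derive1 (derive1 a) x) b p +
  chart s (fun x => - 2 * (x^-1 * derive1 a x) + x ^- 2 * a x)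
    (fun t => t * derive1 b t) p +
  chart s (fun x => x ^- 2 * a x)
    (fun t => t * derive1 (fun t => t * derive1 b t) t + derive1 (derive1 b) t) p.
Proof.
move=> ss sa sb.
have s1 := smooth_onZ s (smooth_on_derive1 sa).
have s2 : smooth_on 1 2 (fun x => - s * kap x * a x).
  by apply: smooth_onMl => //; apply: smoothM; [exact: smooth_cst|exact: smooth_kap].
have s3 : smooth_on c d (fun t => t * derive1 b t).
  by apply: smooth_onMl; [exact: smooth_id|exact: smooth_on_derive1].
have s4 : smooth_on 1 2 (fun x => kap x * a x).
  by apply: smooth_onMl => //; exact: smooth_kap.
have sb' := smooth_on_derive1 sb.
rewrite /laplacian (dx1_chart _ sa sb) (dx2_chart _ sa sb) dx1D; first last.
- by move=> q; have [] := is_derive_chart_fst s q s2 s3.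
- by move=> q; have [] := is_derive_chart_fst s q s1 sb.
rewrite (dx1_chart _ s1 sb) (dx1_chart _ s2 s3) (dx2_chart _ s4 sb').
case: p => x y; rewrite /chart /=.
have [xx|xx] := boolP (1 <= s * x <= 2); last first.
  have sa1 := smooth_on_derive1 sa; have sa2 := smooth_on_derive1 sa1.
  rewrite !(smooth_on_eq0 sa xx) !(smooth_on_eq0 sa1 xx) !(smooth_on_eq0 sa2 xx).
  rewrite !(smooth_on_eq0 (smooth_on_derive1 s1) xx).
  by rewrite !(smooth_on_eq0 (smooth_on_derive1 s2) xx) !(mulr0, mul0r, addr0).
set z := s * x in xx *.
have z2 : 1 / 2 < z by lra.
have z0 : z != 0 by rewrite gt_eqF//; lra.
have da := smooth_is_derive sa.1 z.
have d2a := smooth_is_derive (smooth_on_derive1 sa).1 z.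
have -> : derive1 (fun x => s * derive1 a x) z = s * derive1 (derive1 a) z.
  by have [_] := is_deriveZ s d2a; rewrite -derive1E.
have -> : derive1 (fun x => - s * kap x * a x) z =
    - s * (z^-1 * derive1 a z - z ^- 2 * a z).
  have [_] := is_deriveM (is_deriveZ (- s) (is_derive_kap z2)) da.
  rewrite -derive1E => ->.
  by rewrite -[X in X *: _ + _]/(- s * kap z) /GRing.scale/= kapE//; ring.
rewrite kapE//.
set T := y * z^-1; set B := b T.
set B1 := derive1 b T; set B2 := derive1 (derive1 b) T; set D := derive1 _ T.
have -> : s * (s * derive1 (derive1 a) z) * B = s * s * derive1 (derive1 a) z * B by ring.
(* [s * s] is kept as a visible factor so that it can be replaced by 1. *)
transitivity (s * s * (derive1 (derive1 a) z * B - 2 * (z^-1 * derive1 a z * (T * B1)) +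
  z ^- 2 * a z * (T * B1) + z ^- 2 * a z * (T * D)) + z ^- 2 * a z * B2).
  by field.
by rewrite ss; ring.
Qed.

End WeakEquation.

(** * Integrating out x: the weak equation in the slope *)

Section SlopeEquation.
Variable R : realType.
Implicit Types (f g a b h : R -> R) (c d s x t : R) (p : R * R) (u : R * R -> R).
Local Notation mu := (@lebesgue_measure R).

Lemma continuous_RintegralZ (k : R) f c d : continuous f ->
  \int[mu]_(t in `[c, d]) (k * f t) = k * \int[mu]_(t in `[c, d]) f t.
Proof. by move=> cf; rewrite RintegralZl//; exact: continuous_Rintegrable. Qed.

Lemma continuous_RintegralD f g c d : continuous f -> continuous g ->
  \int[mu]_(t in `[c, d]) (f t + g t) =
  \int[mu]_(t in `[c, d]) f t + \int[mu]_(t in `[c, d]) g t.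
Proof.
by move=> cf cg; rewrite RintegralD//; exact: continuous_Rintegrable.
Qed.

Lemma continuous_RintegralB f g c d : continuous f -> continuous g ->
  \int[mu]_(t in `[c, d]) (f t - g t) =
  \int[mu]_(t in `[c, d]) f t - \int[mu]_(t in `[c, d]) g t.
Proof.
by move=> cf cg; rewrite RintegralB//; exact: continuous_Rintegrable.
Qed.

(** Since s^2 = 1, s Z (s x) is a primitive; for s = -1 the exchange of the endpoints cancels the
    sign. *)
Lemma Rintegral_derive_signed (Z : R -> R) s : s = 1 \/ s = -1 -> smooth Z ->
  \int[mu]_(x in `[(-3), 3]) derive1 Z (s * x) = Z 3 - Z (-3).
Proof.
move=> s1 sZ.
have ss : s * s = 1 by case: s1 => ->; rewrite ?mulrNN mulr1.
have dl (z : R) : is_derive z 1 (fun x => s * x) s.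
  by apply: (is_derive_eq (is_deriveZ s (is_derive_id z (1 : R)))); rewrite /GRing.scale/= mulr1.
have dF (x : R) : is_derive x 1 (fun x => s * Z (s * x)) (derive1 Z (s * x)).
  have dZ := @is_derive1_comp _ Z (fun x => s * x) x _ _
    (smooth_is_derive sZ _) (dl x).
  apply: (is_derive_eq (is_deriveZ s dZ)).
  by rewrite /GRing.scale/= mulrCA ss mulr1.
rewrite (Rintegral_is_derive _ dF) //; first last.
- move=> x; apply: (@continuous_comp _ _ _ (fun x : R => s * x) (derive1 Z)).
    by apply: cvgM; [exact: cvg_cst|exact: cvg_id].
  exact/smooth_continuous/smooth_derive1.
- lra.
case: s1 => ->; first by rewrite !mul1r.
have -> : -1 * (3 : R) = -3 by lra.
have -> : -1 * (-3 : R) = 3 by lra.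
by lra.
Qed.

(* Normalizes the factor [a] of the test functions: the integrals in [x] that
   come out of Fubini are all multiples of this moment. *)
Lemma unit_mass : exists a : R -> R, smooth_on 1 2 a /\
  forall s, s = 1 \/ s = -1 ->
  \int[mu]_(x in `[(-3), 3]) ((s * x) ^+ 2 * a (s * x)) = 1.
Proof.
have [T [sT T0 T1 _ T'0]] := @smooth_step_at R 1 1 ltr01.
have T'0' x : ~~ (1 <= x <= 2) -> derive1 T x = 0.
  by move=> x0; apply: T'0; apply: contra x0; lra.
have sk := @smooth_kap R.
exists (fun x => kap x * (kap x * derive1 T x)); split.
  by do 2 apply: smooth_onMl => //; split => //; exact: smooth_derive1.
move=> s s1.
transitivity (T 3 - T (-3)); last by rewrite T1 ?T0 ?subr0//; lra.
rewrite -(Rintegral_derive_signed s1 sT); apply: eq_Rintegral => x _.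
have [xx|xx] := boolP (1 <= s * x <= 2); last by rewrite T'0'// !mulr0.
rewrite kapE; last lra.
by move: (s * x) xx => z xx; field; rewrite gt_eqF//; lra.
Qed.

(** Integration by parts in x, in divergence form: the exact part Z' integrates to 0 because Z
    vanishes at -3 and 3, and k times the normalized moment remains. *)
Lemma Rintegral_moment a s (Z f : R -> R) (k : R) :
  s = 1 \/ s = -1 -> smooth_on 1 2 a -> smooth_on 1 2 Z ->
  (forall x, x * f x = derive1 Z x + k * (x ^+ 2 * a x)) ->
  \int[mu]_(x in `[(-3), 3]) ((s * x) ^+ 2 * a (s * x)) = 1 ->
  \int[mu]_(x in `[(-3), 3]) (s * x * f (s * x)) = k.
Proof.
move=> s1 sa sZ fE m1.
have cs (g : R -> R) : continuous g -> continuous (fun x => g (s * x)).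
  move=> cg x; apply: (@continuous_comp _ _ _ (fun x : R => s * x) g); last exact: cg.
  by apply: cvgM; [exact: cvg_cst|exact: cvg_id].
have cZ : continuous (fun x => derive1 Z (s * x)).
  by apply: cs; apply/smooth_continuous/smooth_derive1; case: sZ.
have ca : continuous (fun x => (s * x) ^+ 2 * a (s * x)).
  apply: (cs (fun x => x ^+ 2 * a x)); apply: smooth_continuous.
  by apply: smoothM; [apply: smoothX; exact: smooth_id|case: sa].
have cka : continuous (fun x => k * ((s * x) ^+ 2 * a (s * x))).
  by move=> x; apply: cvgM; [exact: cvg_cst|exact: ca].
under eq_Rintegral do rewrite fE.
rewrite RintegralD//; try exact: continuous_Rintegrable.
rewrite RintegralZl//; last exact: continuous_Rintegrable.
rewrite m1 mulr1 Rintegral_derive_signed//; last by case: sZ.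
by rewrite !(smooth_on_eq0 sZ) ?subrr ?add0r//; lra.
Qed.

Lemma enorm_slope s x t : s * s = 1 -> 0 < s * x ->
  enorm (x, t * (s * x)) = s * x * Num.sqrt (1 + t ^+ 2).
Proof.
move=> ss k0; rewrite /enorm/=.
have -> : x ^+ 2 + (t * (s * x)) ^+ 2 = (s * x) ^+ 2 * (1 + t ^+ 2).
  transitivity (s * s * x ^+ 2 + (t * (s * x)) ^+ 2); first by rewrite ss mul1r.
  by ring.
by rewrite sqrtrM ?sqr_ge0// sqrtr_sqr gtr0_norm.
Qed.

(** Weak form of (1 + t^2) h'' - 4 t h' + 6 h = sqrt (1 + t^2), all derivatives being on b. The
    three groups of the Laplacian have moments 12, 7 and 1; 8 is 7 + 1 because t (t b')' contributes
    one more t b'. *)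
Lemma slope_equation u s c d b : s = 1 \/ s = -1 -> c < d ->
  homogeneous 3 u ->
  laplacian_eq_in_distributions u (fun p => enorm p * \1_[set q | 0 < u q] p) ->
  continuous (fun t => u (s, t)) ->
  (forall t, c <= t <= d -> 0 < u (s, t)) -> smooth_on c d b ->
  \int[mu]_(t in `[c, d]) (u (s, t) * (12 * b t + 8 * (t * derive1 b t)
      + (1 + t ^+ 2) * derive1 (derive1 b) t) - Num.sqrt (1 + t ^+ 2) * b t) = 0.
Proof.
move=> s1 cd hom lapl ch h0 sb.
have ss : s * s = 1 by case: s1 => ->; rewrite ?mulrNN mulr1.
have ns : `|s| = 1 by case: s1 => ->; rewrite ?normrN normr1.
have [a [sa /(_ s s1) ma]] := unit_mass.
pose h t := u (s, t).
have sa1 := smooth_on_derive1 sa; have sa2 := smooth_on_derive1 sa1.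
have sb1 := smooth_on_derive1 sb; have sb2 := smooth_on_derive1 sb1.
have sid := @smooth_id R.
(* The x-factors of the Laplacian, multiplied by the x^3 that homogeneity extracts from u. [P3] also
   serves the right-hand side, where the Euclidean norm contributes one power of s x. *)
pose P1 x := x ^+ 3 * derive1 (derive1 a) x.
pose P2 x := - 2 * x ^+ 2 * derive1 a x + x * a x.
pose P3 x := x * a x.
have stb := smooth_onMl sid sb1.
have cX n : smooth (fun x : R => x ^+ n) by exact: smoothX.
have cP1 : continuous P1.
  by apply/smooth_continuous/smoothM => //; case: sa2.
have cP3 : continuous P3.
  by apply/smooth_continuous/smoothM => //; case: sa.
have cP2 : continuous P2.
  apply/smooth_continuous/smoothD; apply: smoothM => //; try by case: sa.
    by apply: smoothM => //; exact: smooth_cst.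
  by case: sa1.
have P10 x : ~~ (1 <= x <= 2) -> P1 x = 0.
  by move=> x0; rewrite /P1 (smooth_on_eq0 sa2)// mulr0.
have P30 x : ~~ (1 <= x <= 2) -> P3 x = 0.
  by move=> x0; rewrite /P3 (smooth_on_eq0 sa)// mulr0.
have P20 x : ~~ (1 <= x <= 2) -> P2 x = 0.
  by move=> x0; rewrite /P2 (smooth_on_eq0 sa)// (smooth_on_eq0 sa1)// !mulr0 addr0.
pose B1 t := h t * b t.
pose B2 t := h t * (t * derive1 b t).
pose E t := t * derive1 (fun t => t * derive1 b t) t + derive1 (derive1 b) t.
pose B3 t := h t * E t.
pose B4 t := Num.sqrt (1 + t ^+ 2) * b t.
have sE : smooth_on c d E.
  split; last first.
    move=> t t0; rewrite /E (smooth_on_eq0 sb2)// (smooth_on_eq0 (smooth_on_derive1 stb))//.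
    by rewrite mulr0 addr0.
  apply: smoothD; last by case: sb2.
  by apply: smoothM => //; case: (smooth_on_derive1 stb).
have chM (f : R -> R) : smooth f -> continuous (fun t => h t * f t).
  by move=> sf t; apply: cvgM; [exact: ch|exact: smooth_continuous].
have cB1 : continuous B1 by apply: chM; case: sb.
have cB2 : continuous B2 by apply: chM; case: stb.
have cB3 : continuous B3 by apply: chM; case: sE.
have cB4 : continuous B4.
  move=> t; apply: cvgM; last by apply: smooth_continuous; case: sb.
  apply: (@continuous_comp _ _ _ (fun t : R => 1 + t ^+ 2) Num.sqrt).
    by apply: cvgD; [exact: cvg_cst|exact: (smooth_continuous (cX 2%N))].
  exact: sqrt_continuous.
have B10 t : ~~ (c <= t <= d) -> B1 t = 0.
  by move=> t0; rewrite /B1 (smooth_on_eq0 sb)// mulr0.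
have B20 t : ~~ (c <= t <= d) -> B2 t = 0.
  by move=> t0; rewrite /B2 (smooth_on_eq0 stb)// mulr0.
have B30 t : ~~ (c <= t <= d) -> B3 t = 0.
  by move=> t0; rewrite /B3 (smooth_on_eq0 sE)// mulr0.
have B40 t : ~~ (c <= t <= d) -> B4 t = 0.
  by move=> t0; rewrite /B4 (smooth_on_eq0 sb)// mulr0.
have K1 : \int[mu]_(x in `[(-3), 3]) (s * x * P1 (s * x)) = 12.
  (* Two integrations by parts: x^4 a'' = Z' + 12 x^2 a. *)
  pose Z x := x ^+ 4 * derive1 a x + - 4 * (x ^+ 3 * a x).
  have sZ : smooth_on 1 2 Z.
    split; last first.
      by move=> x x0; rewrite /Z (smooth_on_eq0 sa)// (smooth_on_eq0 sa1)// !mulr0 addr0.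
    apply: smoothD; first by apply: smoothM => //; case: sa1.
    apply: smoothM; first exact: smooth_cst.
    by apply: smoothM => //; case: sa.
  apply: (Rintegral_moment s1 sa sZ) ma => x.
  have d1 := smooth_is_derive sa1.1 x; have d0 := smooth_is_derive sa.1 x.
  have dX n := is_derive_pow n (is_derive_id x (1 : R)).
  have [_] := is_deriveD (is_deriveM (dX 4%N) d1)
    (is_deriveZ (-4) (is_deriveM (dX 3%N) d0)).
  by rewrite -derive1E /P1 => ->; rewrite /GRing.scale/=; ring.
have K2 : \int[mu]_(x in `[(-3), 3]) (s * x * P2 (s * x)) = 7.
  (* Here x [P2] = Z' + 7 x^2 a: 6 comes from -2 x^3 a' and 1 from the term x^2 a. *)
  pose Z x := - 2 * (x ^+ 3 * a x).
  have sZ : smooth_on 1 2 Z by apply: smooth_onZ; exact: smooth_onMl.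
  apply: (Rintegral_moment s1 sa sZ) ma => x.
  have d0 := smooth_is_derive sa.1 x.
  have dX n := is_derive_pow n (is_derive_id x (1 : R)).
  have [_] := is_deriveZ (-2) (is_deriveM (dX 3%N) d0).
  by rewrite -derive1E /P2 => ->; rewrite /GRing.scale/=; ring.
have K3 : \int[mu]_(x in `[(-3), 3]) (s * x * P3 (s * x)) = 1.
  by rewrite -[RHS]ma; apply: eq_Rintegral => x _; rewrite /P3; ring.
have cd' := ltW cd.
have [i1 e1] := chart_integral ns cd' cP1 cB1 P10 B10.
have [i2 e2] := chart_integral ns cd' cP2 cB2 P20 B20.
have [i3 e3] := chart_integral ns cd' cP3 cB3 P30 B30.
have [i4 e4] := chart_integral ns cd' cP3 cB4 P30 B40.
have := lapl _ (test_function_chart ns sa sb).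
have -> : (\int[@lebesgue2 R]_p (u p * laplacian (chart s a b) p)%:E =
  \int[(mu \x mu)%E]_p ((chart s P1 B1 p)%:E + (chart s P2 B2 p)%:E
    + (chart s P3 B3 p)%:E))%E.
  apply: eq_integral => -[x y] _; rewrite -!EFinD; congr EFin.
  rewrite (laplacian_chart _ ss sa sb) /chart /=.
  have [xx|xx] := boolP (1 <= s * x <= 2); last first.
    rewrite !P10// P20// P30// (smooth_on_eq0 sa xx) (smooth_on_eq0 sa1 xx).
    by rewrite (smooth_on_eq0 sa2 xx) !(mulr0, mul0r, addr0).
  have z0 : 0 < s * x by case/andP: xx => xx _; exact: lt_le_trans xx.
  have z2 : 1 / 2 < s * x by case/andP: xx => xx _; apply: lt_le_trans xx; clear; lra.
  rewrite (homogeneous_slope _ ss hom z0) !kapE//.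
  rewrite /P1 /P2 /P3 /B1 /B2 /B3 /E /h.
  move: (y / (s * x)) (s * x) z0 => t z z0.
  move: (derive1 (fun t => t * derive1 b t) t) (derive1 (derive1 b) t) (derive1 b t).
  move: (b t) (u (s, t)) (derive1 (derive1 a) z) (derive1 a z) (a z) => *.
  by field; rewrite gt_eqF.
have -> : (\int[@lebesgue2 R]_p
    (enorm p * \1_[set q | 0 < u q] p * chart s a b p)%:E =
  \int[(mu \x mu)%E]_p (chart s P3 B4 p)%:E)%E.
  apply: eq_integral => -[x y] _; congr EFin; rewrite /chart /=.
  have [xx|xx] := boolP (1 <= s * x <= 2); last first.
    by rewrite P30// (smooth_on_eq0 sa xx) !(mulr0, mul0r).
  have z0 : 0 < s * x by case/andP: xx => xx _; exact: lt_le_trans xx.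
  have z2 : 1 / 2 < s * x by case/andP: xx => xx _; apply: lt_le_trans xx; clear; lra.
  rewrite !kapE//.
  have [tt|tt] := boolP (c <= y / (s * x) <= d); last first.
    by rewrite B40// (smooth_on_eq0 sb tt) !(mulr0, mul0r).
  (* On the support of b positivity of u (s, t) makes the indicator of {u > 0} equal to 1. *)
  rewrite indicE mem_set ?mulr1; last first.
    rewrite /= (homogeneous_slope _ ss hom z0) mulr_gt0 ?exprn_gt0//.
    exact: h0.
  have -> : (x, y) = (x, y / (s * x) * (s * x)) by rewrite divfK// gt_eqF.
  by rewrite enorm_slope// /P3 /B4; ring.
rewrite integralD//; last exact: integrableD.
rewrite integralD// e1 e2 e3 e4 K1 K2 K3 -!EFinD => -[] EQ.
transitivity (12 * \int[mu]_(t in `[c, d]) B1 t + 7 * \int[mu]_(t in `[c, d]) B2 t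
  + \int[mu]_(t in `[c, d]) B3 t - \int[mu]_(t in `[c, d]) B4 t); last first.
  by move: EQ; rewrite !mul1r => ->; rewrite subrr.
have CZ k (f : R -> R) : continuous f -> continuous (fun x => k * f x).
  by move=> cf x; apply: cvgM; [exact: cvg_cst|exact: cf].
have CD (f g : R -> R) : continuous f -> continuous g -> continuous (fun x => f x + g x).
  by move=> cf cg x; apply: cvgD; [exact: cf|exact: cg].
have J1 := CZ 12 _ cB1; have J2 := CZ 7 _ cB2.
have J3 := CD _ _ J1 J2; have J4 := CD _ _ J3 cB3.
rewrite -(continuous_RintegralZ 12 _ _ cB1) -(continuous_RintegralZ 7 _ _ cB2).
rewrite -(continuous_RintegralD _ _ J1 J2) -(continuous_RintegralD _ _ J3 cB3).
rewrite -(continuous_RintegralB _ _ J4 cB4).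
apply: eq_Rintegral => t _.
rewrite /B1 /B2 /B3 /B4 /E /h.
have [_] := is_deriveM (is_derive_id t (1 : R)) (smooth_is_derive sb1.1 t).
by rewrite -derive1E => ->; rewrite /GRing.scale/=; ring.
Qed.

End SlopeEquation.

(** * First integrals of the slope equation *)

Section FirstIntegrals.
Variable R : realType.
Implicit Types (f g a b h : R -> R) (c d s x t : R) (p : R * R) (u : R * R -> R).
Local Notation mu := (@lebesgue_measure R).

Lemma onedsqr_gt0 t : 0 < 1 + t ^+ 2.
Proof. by rewrite ltr_pwDl// sqr_ge0. Qed.

Lemma smooth_poly_id n (k : R) : smooth (fun t => k * t ^+ n).
Proof.
by apply: smoothM; [exact: smooth_cst|apply: smoothX; exact: smooth_id].
Qed.

Lemma smooth_onedsqr : smooth (fun t : R => 1 + t ^+ 2).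
Proof.
by apply: smoothD; [exact: smooth_cst|apply: smoothX; exact: smooth_id].
Qed.

Lemma smooth_onedsqrV : smooth (fun t : R => (1 + t ^+ 2)^-1).
Proof.
apply: smoothV; last exact: smooth_onedsqr.
by move=> t; rewrite gt_eqF// onedsqr_gt0.
Qed.

Lemma is_derive_onedsqr t : is_derive t 1 (fun t : R => 1 + t ^+ 2) (2 * t).
Proof.
have d := is_derive_pow 2 (is_derive_id t (1 : R)).
apply: (is_derive_eq (is_deriveD (is_derive_cst (1 : R) t (1 : R)) d)).
by rewrite add0r mulr1 expr1.
Qed.

Lemma is_derive_onedsqrV t :
  is_derive t 1 (fun t : R => (1 + t ^+ 2)^-1) (- 2 * t * (1 + t ^+ 2)^-1 ^+ 2).
Proof.
have n0 : 1 + t ^+ 2 != 0 by rewrite gt_eqF// onedsqr_gt0.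
apply: (is_derive_eq (@is_deriveV _ (fun t : R => 1 + t ^+ 2) t _ 1 n0
  (is_derive_onedsqr t))).
by rewrite /GRing.scale/= -exprVn; ring.
Qed.

(* [q] solves the homogeneous slope equation, so its Wronskian with [h] divided
   by [(1 + t ^ 2) ^ 2] has a derivative that does not involve [h]; [S] is a
   primitive of it. The test function [q w ^ 3 be], with [w = 1 / (1 + t ^ 2)],
   turns the weak equation into [\int M be' = 0]. *)
Lemma slope_first_integral u s c d (h' q q1 q2 S : R -> R) :
  s = 1 \/ s = -1 -> c < d -> homogeneous 3 u ->
  laplacian_eq_in_distributions u (fun p => enorm p * \1_[set q | 0 < u q] p) ->
  (forall t : R, is_derive t 1 (fun t => u (s, t)) (h' t)) -> continuous h' ->
  (forall t, c <= t <= d -> 0 < u (s, t)) ->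
  smooth q -> (forall t : R, is_derive t 1 q (q1 t)) ->
  (forall t : R, is_derive t 1 q1 (q2 t)) ->
  (forall t, (1 + t ^+ 2) * q2 t - 4 * t * q1 t + 6 * q t = 0) ->
  (forall t : R, is_derive t 1 S
     (- (q t * (1 + t ^+ 2)^-1 ^+ 3 * Num.sqrt (1 + t ^+ 2)))) ->
  forall t t', c < t < d -> c < t' < d ->
  (u (s, t) * q1 t - h' t * q t) * (1 + t ^+ 2)^-1 ^+ 2 - S t =
  (u (s, t') * q1 t' - h' t' * q t') * (1 + t' ^+ 2)^-1 ^+ 2 - S t'.
Proof.
move=> s1 cd hom lapl dh ch' h0 sq dq dq1 ode dS.
pose h t := u (s, t); pose w t : R := (1 + t ^+ 2)^-1.
pose v t := Num.sqrt (1 + t ^+ 2).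
have ch : continuous h := is_derive_continuous dh.
have sw : smooth w := smooth_onedsqrV.
have cX (F : R -> R) n : continuous F -> continuous (fun t => F t ^+ n).
  move=> cF t; apply: (@continuous_comp _ _ _ F (fun x => x ^+ n)); first exact: cF.
  exact: (smooth_continuous (smoothX n (@smooth_id R))).
have cM (F G : R -> R) : continuous F -> continuous G -> continuous (fun t => F t * G t).
  by move=> cF cG t; apply: cvgM; [exact: cF|exact: cG].
have cD (F G : R -> R) : continuous F -> continuous G -> continuous (fun t => F t + G t).
  by move=> cF cG t; apply: cvgD; [exact: cF|exact: cG].
have cB (F G : R -> R) : continuous F -> continuous G -> continuous (fun t => F t - G t).
  by move=> cF cG t; apply: cvgB; [exact: cF|exact: cG].
have cq := smooth_continuous sq.
have cq1 := is_derive_continuous dq1.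
have cw := smooth_continuous sw.
have cv : continuous v.
  move=> t; apply: (@continuous_comp _ _ _ (fun t : R => 1 + t ^+ 2) Num.sqrt).
    exact: (smooth_continuous smooth_onedsqr).
  exact: sqrt_continuous.
pose M t := (h t * q1 t - h' t * q t) * w t ^+ 2 - S t.
have cMM : continuous M.
  apply: (cB); last exact: (is_derive_continuous dS).
  by apply: (cM); [apply: (cB); exact: cM|exact: cX].
apply: (@du_bois_reymond _ M c d cMM) => be c' d' cc' d'd sbe be0.
have sb1 : smooth_on c' d' be by [].
have sb2 := smooth_on_derive1 sb1; have sb3 := smooth_on_derive1 sb2.
pose b t := q t * w t ^+ 3 * be t.
have sb : smooth_on c d b.
  split; first by do 2 apply: smoothM => //; exact: smoothX.
  move=> t t0; rewrite /b be0 ?mulr0//; apply: contra t0 => /andP[h1 h2].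
  by rewrite (le_trans (ltW cc') h1) (le_trans h2 (ltW d'd)).
pose g1 t := q1 t * w t ^+ 3 - 6 * t * q t * w t ^+ 4.
pose g2 t := q2 t * w t ^+ 3 - 12 * t * q1 t * w t ^+ 4 - 6 * q t * w t ^+ 4
  + 48 * t ^+ 2 * q t * w t ^+ 5.
have dw (t : R) : is_derive t 1 w (- 2 * t * w t ^+ 2) := is_derive_onedsqrV t.
have dwn n (t : R) := is_derive_pow n (dw t).
have dbe := smooth_is_derive sbe; have dbe1 := smooth_is_derive sb2.1.
have dg (t : R) : is_derive t 1 (fun t => q t * w t ^+ 3) (g1 t).
  apply: (is_derive_eq (is_deriveM (dq t) (dwn 3%N t))).
  by rewrite /GRing.scale/= /g1; ring.
have dg1 (t : R) : is_derive t 1 g1 (g2 t).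
  have dtq := is_deriveM (is_derive_id t (1 : R)) (is_deriveM (dq t) (dwn 4%N t)).
  have E : g1 = (q1 * (fun t => w t ^+ 3)) -
      6 *: (id * (q * (fun t => w t ^+ 4))).
    apply/funext => z; rewrite /g1.
    transitivity (q1 z * w z ^+ 3 - 6 * (z * (q z * w z ^+ 4))) => //.
    by ring.
  rewrite E; apply: (is_derive_eq
    (is_deriveB (is_deriveM (dq1 t) (dwn 3%N t)) (is_deriveZ 6 dtq))).
  rewrite /GRing.scale/= /g2.
  rewrite -[(q * _) t]/(q t * w t ^+ 4); ring.
have db (t : R) : is_derive t 1 b (g1 t * be t + q t * w t ^+ 3 * derive1 be t).
  apply: (is_derive_eq (is_deriveM (dg t) (dbe t))).
  by rewrite /GRing.scale/=; ring.
have d2b (t : R) : is_derive t 1 (derive1 b)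
    (g2 t * be t + 2 * g1 t * derive1 be t + q t * w t ^+ 3 * derive1 (derive1 be) t).
  rewrite (derive1_is_derive db).
  apply: (is_derive_eq (is_deriveD (is_deriveM (dg1 t) (dbe t))
    (is_deriveM (dg t) (dbe1 t)))).
  by rewrite /GRing.scale/=; ring.
have EQ := slope_equation s1 cd hom lapl ch h0 sb.
move: EQ; rewrite (derive1_is_derive d2b) (derive1_is_derive db) => EQ.
(* The exact part: the integrand of the weak equation for [b] is M be' + Z'. [Z] contains h but not
   h', so its derivative needs no second derivative of u, and it vanishes at c and d together with
   be and be'. *)
pose Z t := h t * q t * w t ^+ 2 * derive1 be t + S t * be t.
pose Z1 t := (h' t * q t + h t * q1 t - 4 * t * h t * q t * w t) * w t ^+ 2 * derive1 be t
  + h t * q t * w t ^+ 2 * derive1 (derive1 be) t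
  - q t * w t ^+ 3 * v t * be t + S t * derive1 be t.
have dZ (t : R) : is_derive t 1 Z (Z1 t).
  have d1 := is_deriveM (is_deriveM (is_deriveM (dh t) (dq t)) (dwn 2%N t)) (dbe1 t).
  have d2 := is_deriveM (dS t) (dbe t).
  apply: (is_derive_eq (is_deriveD d1 d2)).
  rewrite /GRing.scale/= /Z1 -/(w t) -/(v t).
  rewrite -[(_ * _ * _) t]/(h t * q t * w t ^+ 2) -[(_ * _) t]/(h t * q t).
  rewrite -/(h t); ring.
have cb0 := smooth_continuous sbe; have cb1 := smooth_continuous sb2.1.
have cb2 := smooth_continuous sb3.1.
have cid : continuous (fun t : R => t) by move=> t; exact: cvg_id.
have ccst (k : R) : continuous (fun _ : R => k) by move=> t; exact: cvg_cst.
have cS := is_derive_continuous dS.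
have cZ1 : continuous Z1.
  rewrite /Z1; apply: (cD); last exact: cM.
  apply: (cB); last by do 2 (apply: (cM) => //); apply: (cM) => //; exact: cX.
  apply: (cD); last by do 2 (apply: (cM) => //); [exact: cM|exact: cX].
  apply: (cM) => //; apply: (cM); last exact: cX.
  apply: (cB); first by apply: (cD); exact: cM.
  by do 4 (apply: (cM) => //).
have Z0 : \int[mu]_(x in `[c, d]) Z1 x = 0.
  rewrite (Rintegral_is_derive cd dZ cZ1) /Z.
  have nc : ~~ (c' <= c <= d') by rewrite negb_and -!ltNge cc'.
  have nd : ~~ (c' <= d <= d') by rewrite negb_and -!ltNge d'd orbT.
  rewrite !(smooth_on_eq0 sb1 nc) !(smooth_on_eq0 sb1 nd).
  by rewrite !(smooth_on_eq0 sb2 nc) !(smooth_on_eq0 sb2 nd) !mulr0 addr0 subrr.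
transitivity (\int[mu]_(t in `[c, d]) (M t * derive1 be t) +
  \int[mu]_(t in `[c, d]) Z1 t); first by rewrite Z0 addr0.
rewrite -continuous_RintegralD//; last exact: cM.
rewrite -[RHS]EQ; apply: eq_Rintegral => t _.
rewrite /M /Z1 /b /g1 /g2 -/(h t) -/(v t).
(* With [q2] eliminated through the differential equation, the remaining identity is rational in t
   with all other values as atoms. *)
have q2E : q2 t = (4 * t * q1 t - 6 * q t) * w t.
  have w0 := onedsqr_gt0 t.
  apply/eqP; rewrite -subr_eq0 /w; apply/eqP; rewrite -(mulr0 (w t)) -(ode t) /w.
  by field; rewrite gt_eqF.
rewrite q2E /w; have := onedsqr_gt0 t.
clear; move: (h t) (h' t) (q t) (q1 t) (S t) (be t) (derive1 be t)
  (derive1 (derive1 be) t) (v t) => {}h {}h' {}q {}q1 {}S b0 b1 b2 {}v.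
by move: (t : R) => {}t n0; field; rewrite gt_eqF.
Qed.

Lemma is_derive_onedsqr_rho t : is_derive t 1
  (fun t : R => (1 + t ^+ 2)^-1 ^+ 2 * Num.sqrt (1 + t ^+ 2))
  (- 3 * t * (1 + t ^+ 2)^-1 ^+ 3 * Num.sqrt (1 + t ^+ 2)).
Proof.
have n0 := onedsqr_gt0 t.
have dv := @is_derive1_comp _ Num.sqrt (fun t => 1 + t ^+ 2) t _ _
  (is_derive1_sqrt n0) (is_derive_onedsqr t).
apply: (is_derive_eq (is_deriveM (is_derive_pow 2 (is_derive_onedsqrV t)) dv)).
rewrite /GRing.scale/=.
have v0 : Num.sqrt (1 + t ^+ 2) != 0 by rewrite gt_eqF// sqrtr_gt0.
have vE : 1 + t ^+ 2 = Num.sqrt (1 + t ^+ 2) ^+ 2 by rewrite sqr_sqrtr// ltW.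
move: (Num.sqrt (1 + t ^+ 2)) v0 vE => v v0 vE; rewrite vE.
by field.
Qed.

Section Charts.
Variables (u : R * R -> R) (s c d : R) (h' : R -> R).
Hypotheses (s1 : s = 1 \/ s = -1) (cd : c < d) (hom : homogeneous 3 u).
Hypothesis lapl :
  laplacian_eq_in_distributions u (fun p => enorm p * \1_[set q | 0 < u q] p).
Hypotheses (dh : forall t : R, is_derive t 1 (fun t => u (s, t)) (h' t))
  (ch' : continuous h') (h0 : forall t, c <= t <= d -> 0 < u (s, t)).

Let rho t : R := (1 + t ^+ 2)^-1 ^+ 2 * Num.sqrt (1 + t ^+ 2).

(** Here q = t - t^3 / 3 is a third of the imaginary part of (1 + i t)^3. Its Wronskian with h
    annihilates the sine component and isolates the cosine coefficient; the subtracted term is the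
    value of the same expression on the particular solution (1 + t^2)^(3/2) / 9. *)
Lemma slope_first_integral_cos t t' : c < t < d -> c < t' < d ->
  (u (s, t) * (1 - t ^+ 2) - h' t * (t - t ^+ 3 / 3)) * (1 + t ^+ 2)^-1 ^+ 2
    - (1 - 3 * t ^+ 2) / 9 * rho t =
  (u (s, t') * (1 - t' ^+ 2) - h' t' * (t' - t' ^+ 3 / 3)) * (1 + t' ^+ 2)^-1 ^+ 2
    - (1 - 3 * t' ^+ 2) / 9 * rho t'.
Proof.
have dX n (t : R) := is_derive_pow n (is_derive_id t (1 : R)).
move=> ht ht'; refine (@slope_first_integral u s c d h' (fun t => t - t ^+ 3 / 3)
  (fun t => 1 - t ^+ 2) (fun t => - 2 * t)
  (fun t => (1 - 3 * t ^+ 2) / 9 * rho t)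
  s1 cd hom lapl dh ch' h0 _ _ _ _ _ t t' ht ht').
- have -> : (fun t : R => t - t ^+ 3 / 3) = (fun t => 1 * t ^+ 1 + (- 3^-1) * t ^+ 3).
    by apply/funext => z; field.
  by apply: smoothD; exact: smooth_poly_id.
- move=> z; have -> : (fun t : R => t - t ^+ 3 / 3) = id + (- 3^-1) *: (fun t => t ^+ 3).
    by apply/funext => y; rewrite mulrC -mulNr.
  apply: (is_derive_eq (is_deriveD (is_derive_id z (1 : R)) (is_deriveZ _ (dX 3%N z)))).
  by rewrite /GRing.scale/=; field.
- move=> z; have -> : (fun t : R => 1 - t ^+ 2) = cst 1 - (fun t => t ^+ 2) by [].
  apply: (is_derive_eq (is_deriveB (is_derive_cst (1 : R) z (1 : R)) (dX 2%N z))).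
  by rewrite /=; ring.
- by move=> z; field.
- move=> z; have E : (fun t : R => (1 - 3 * t ^+ 2) / 9 * rho t) =
      9^-1 *: ((cst 1 - 3 *: (fun t => t ^+ 2)) * rho).
    apply/funext => y.
    by rewrite -[RHS]/(9^-1 * ((1 - 3 * y ^+ 2) * rho y)); ring.
  rewrite E.
  have d1 := is_deriveB (is_derive_cst (1 : R) z (1 : R)) (is_deriveZ 3 (dX 2%N z)).
  apply: (is_derive_eq (is_deriveZ 9^-1 (is_deriveM d1 (is_derive_onedsqr_rho z)))).
  rewrite -[(_ - _) z]/(1 - 3 * z ^+ 2) /GRing.scale/= /rho.
  by have n0 := onedsqr_gt0 z; field; rewrite gt_eqF.
Qed.

(** Companion with a third of the real part, which isolates the sine coefficient up to sign. *)
Lemma slope_first_integral_sin t t' : c < t < d -> c < t' < d ->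
  (u (s, t) * (- 2 * t) - h' t * ((1 - 3 * t ^+ 2) / 3)) * (1 + t ^+ 2)^-1 ^+ 2
    + (3 * t - t ^+ 3) / 9 * rho t =
  (u (s, t') * (- 2 * t') - h' t' * ((1 - 3 * t' ^+ 2) / 3)) * (1 + t' ^+ 2)^-1 ^+ 2
    + (3 * t' - t' ^+ 3) / 9 * rho t'.
Proof.
have dX n (t : R) := is_derive_pow n (is_derive_id t (1 : R)).
move=> ht ht'; rewrite -[X in _ + X]opprK -[X in _ = _ + X]opprK.
refine (@slope_first_integral u s c d h' (fun t => (1 - 3 * t ^+ 2) / 3)
  (fun t => - 2 * t) (fun t => - 2)
  (fun t => - ((3 * t - t ^+ 3) / 9 * rho t))
  s1 cd hom lapl dh ch' h0 _ _ _ _ _ t t' ht ht').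
- have -> : (fun t : R => (1 - 3 * t ^+ 2) / 3) = (fun t => 3^-1 * t ^+ 0 + (- 1) * t ^+ 2).
    by apply/funext => z; field.
  by apply: smoothD; exact: smooth_poly_id.
- move=> z; have -> : (fun t : R => (1 - 3 * t ^+ 2) / 3) = cst 3^-1 - (fun t => t ^+ 2).
    by apply/funext => y; transitivity (3^-1 - y ^+ 2) => //; field.
  apply: (is_derive_eq (is_deriveB (is_derive_cst (3^-1 : R) z (1 : R)) (dX 2%N z))).
  by rewrite /=; ring.
- move=> z; apply: (is_derive_eq (is_deriveZ (-2) (is_derive_id z (1 : R)))).
  by rewrite /GRing.scale/= mulr1.
- by move=> z; field.
- move=> z; have E : (fun t : R => - ((3 * t - t ^+ 3) / 9 * rho t)) =
      (- 9^-1) *: ((3 *: id - (fun t => t ^+ 3)) * rho).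
    apply/funext => y.
    by rewrite -[RHS]/(- 9^-1 * ((3 * y - y ^+ 3) * rho y)); ring.
  rewrite E.
  have d1 := is_deriveB (is_deriveZ 3 (is_derive_id z (1 : R))) (dX 3%N z).
  apply: (is_derive_eq (is_deriveZ (- 9^-1) (is_deriveM d1 (is_derive_onedsqr_rho z)))).
  rewrite -[(_ - _) z]/(3 * z - z ^+ 3) /GRing.scale/= /rho.
  by have n0 := onedsqr_gt0 z; field; rewrite gt_eqF.
Qed.

End Charts.

End FirstIntegrals.

(** * The trace on the unit circle *)

Section Angular.
Variable R : realType.
Implicit Types (c d s t x y z th : R) (p : R * R) (u F : R * R -> R).

Lemma lipschitz_compact_continuous F :
  (forall K : set (R * R), compact K -> [lipschitz F p | p in K]) -> continuous F.
Proof.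
move=> lF p.
pose K := `[p.1 - 1, p.1 + 1]%classic `*` `[p.2 - 1, p.2 + 1]%classic.
have cK : compact K by apply: compact_setX; exact: segment_compact.
have [k [k_real kF]] := lF K cK.
(* The Lipschitz predicate gives the bound for every constant beyond some [k]; [m] is one that is
   also positive, so that it can be divided by. *)
pose m := Num.max k 0 + 1.
have km : k < m by rewrite /m ltr_pwDr// le_max lexx.
have m0 : 0 < m by rewrite /m ltr_wpDl// le_max lexx orbT.
have KF := kF m km.
have near_dist (r : R) : 0 < r -> \forall q \near p, `|p - q| < r.
  by move=> r0; apply/nbhs_normP; exists r.
apply/cvgrPdist_lt => e e0; have em0 : 0 < e / m by rewrite divr_gt0.
near=> q.
have qp : `|p - q| < e / m.
  by near: q; exact: near_dist.
have qp1 : `|p - q| < 1.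
  by near: q; exact: near_dist.
have pK : K p by split => /=; rewrite in_itv/=; apply/andP; split; lra.
have qK : K q.
  move: qp1; rewrite prod_normE/= gt_max !ltr_norml => /andP[h1 h2].
  by split => /=; rewrite in_itv/=; lra.
have := KF (p, q) (conj pK qK) => /= /le_lt_trans; apply.
by rewrite mulrC -ltr_pdivlMr.
Unshelve. all: by end_near. Qed.

Lemma derivable_fst F p : derivable F p (1, 0) ->
  is_derive p.1 1 (fun x : R => F (x, p.2)) (dx1 F p).
Proof. by move=> dF; apply/is_derive_fst; exact: derivableP. Qed.

Lemma derivable_snd F p : derivable F p (0, 1) ->
  is_derive p.2 1 (fun y : R => F (p.1, y)) (dx2 F p).
Proof. by move=> dF; apply/is_derive_snd; exact: derivableP. Qed.

Variable u : R * R -> R.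
Hypothesis u_sol : homogeneous_global_solution u.

Let udiff p v : derivable u p v.
Proof. by have [[du _] _ _ _] := u_sol; exact: diff_derivable. Qed.

Let ucont : continuous u.
Proof. by have [[du _] _ _ _] := u_sol => p; exact: differentiable_continuous. Qed.

Let dx1cont : continuous (dx1 u).
Proof.
have [[_ lu] _ _ _] := u_sol.
by apply: lipschitz_compact_continuous => K /lu[].
Qed.

Let dx2cont : continuous (dx2 u).
Proof.
have [[_ lu] _ _ _] := u_sol.
by apply: lipschitz_compact_continuous => K /lu[].
Qed.

Let uhom : homogeneous 3 u. Proof. by have [] := u_sol. Qed.

Let is_derive_slope s t : is_derive t 1 (fun t => u (s, t)) (dx2 u (s, t)).
Proof. by have := derivable_snd (@udiff (s, t) (0, 1)). Qed.

Lemma slope_dx2 s x y : s * s = 1 -> 0 < s * x ->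
  dx2 u (x, y) = (s * x) ^+ 2 * dx2 u (s, y / (s * x)).
Proof.
move=> ss k0; have kn : s * x != 0 by rewrite gt_eqF.
have [_ <-] := derivable_snd (@udiff (x, y) (0, 1)).
rewrite /= (_ : (fun y => u (x, y)) =
    fun y => (s * x) ^+ 3 * u (s, y / (s * x))); last first.
  by apply/funext => z; rewrite (homogeneous_slope z ss uhom k0).
have dl : is_derive y 1 (fun y => y / (s * x)) (s * x)^-1.
  have := is_derive_affine (s * x)^-1 0 y.
  by under eq_fun do rewrite addr0 mulrC.
have dc := @is_derive1_comp _ (fun t => u (s, t)) (fun y => y / (s * x)) y _ _
  (is_derive_slope _ _) dl.
have [_ ->] := is_deriveZ ((s * x) ^+ 3) dc.
by rewrite /GRing.scale/=; move: (s * x) kn => z zn; field.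
Qed.

Lemma slope_dx1 s x y : s * s = 1 -> 0 < s * x ->
  dx1 u (x, y) = s * (s * x) ^+ 2 *
    (3 * u (s, y / (s * x)) - y / (s * x) * dx2 u (s, y / (s * x))).
Proof.
move=> ss k0; have kn : s * x != 0 by rewrite gt_eqF.
have [_ <-] := derivable_fst (@udiff (x, y) (1, 0)).
(* The slope formula for u needs s z > 0, hence an equality near x only, not of functions. *)
rewrite /= (near_eq_derive (g := fun x => (s * x) ^+ 3 * u (s, y * (s * x)^-1))); last first.
  have cl : s * z @[z --> x] --> s * x.
    by apply: cvgM; [exact: cvg_cst|exact: cvg_id].
  have : \forall z \near x, 0 < s * z.
    exact: (cvgr_gt _ cl).
  by apply: filterS => z z0; rewrite (homogeneous_slope y ss uhom z0).
have dl : is_derive x 1 (fun x => s * x) s.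
  by have := is_derive_affine s 0 x; under eq_fun do rewrite addr0.
have dV := is_deriveZ y (@is_deriveV _ (fun x => s * x) x _ 1 kn dl).
have dc := @is_derive1_comp _ (fun t => u (s, t)) (fun x => y * (s * x)^-1) x _ _
  (is_derive_slope _ _) dV.
have [_ ->] := is_deriveM (is_derive_pow 3 dl) dc.
rewrite /GRing.scale/=; move: (s * x) kn => z zn.
by field.
Qed.

(* [cos (3 th)] and [sin (3 th)], in the form matching the cubic harmonics. *)
Definition cos3 th : R := cos th ^+ 3 - 3 * cos th * sin th ^+ 2.
Definition sin3 th : R := 3 * cos th ^+ 2 * sin th - sin th ^+ 3.
Definition trace th : R := u (cos th, sin th).
Definition dtrace th : R :=
  - sin th * dx1 u (cos th, sin th) + cos th * dx2 u (cos th, sin th).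
(** The system f = 1/9 + A cos3 + B sin3, f' = 3 (B cos3 - A sin3) solved for A and B at a single
    angle. With f' expressed by the gradient, both are defined and continuous at every angle, zeros
    of f and directions cos th = 0 included. *)
Definition coefA th : R :=
  (trace th - 1 / 9) * cos3 th - dtrace th * sin3 th / 3.
Definition coefB th : R :=
  (trace th - 1 / 9) * sin3 th + dtrace th * cos3 th / 3.

(** Pure algebra at each angle, from cos3^2 + sin3^2 = 1; it says something about u only once the
    coefficients are known to be constant. *)
Lemma traceE th : trace th = 1 / 9 + coefA th * cos3 th + coefB th * sin3 th.
Proof.
rewrite /coefA /coefB.
have E : cos3 th ^+ 2 + sin3 th ^+ 2 = 1.
  transitivity ((cos th ^+ 2 + sin th ^+ 2) ^+ 3); first by rewrite /cos3 /sin3; ring.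
  by rewrite cos2Dsin2 expr1n.
transitivity (1 / 9 + (trace th - 1 / 9) * (cos3 th ^+ 2 + sin3 th ^+ 2)).
  by rewrite E; ring.
by field.
Qed.

Lemma continuous_coef : continuous coefA /\ continuous coefB.
Proof.
have cc := @continuous_cos R; have cs := @continuous_sin R.
have cp (F : R * R -> R) : continuous F -> continuous (fun th => F (cos th, sin th)).
  move=> cF th; apply: (@continuous_comp _ _ _ (fun th => (cos th, sin th)) F).
    exact: (cvg_pair (cc th) (cs th)).
  exact: cF.
have cM (f g : R -> R) : continuous f -> continuous g -> continuous (fun t => f t * g t).
  by move=> cf cg t; apply: cvgM; [exact: cf|exact: cg].
have cX (f : R -> R) n : continuous f -> continuous (fun t => f t ^+ n).
  move=> cF t; apply: (@continuous_comp _ _ _ f (fun x => x ^+ n)); first exact: cF.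
  exact: (smooth_continuous (smoothX n (@smooth_id R))).
have cD (f g : R -> R) : continuous f -> continuous g -> continuous (fun t => f t + g t).
  by move=> cf cg t; apply: cvgD; [exact: cf|exact: cg].
have cB (f g : R -> R) : continuous f -> continuous g -> continuous (fun t => f t - g t).
  by move=> cf cg t; apply: cvgB; [exact: cf|exact: cg].
have ck (k : R) : continuous (fun _ : R => k) by move=> t; exact: cvg_cst.
have c3 : continuous cos3.
  by apply: (cB); [exact: cX|apply: (cM); [apply: (cM)|apply: (cX)]].
have s3 : continuous sin3.
  by apply: (cB); [apply: (cM) => //; apply: (cM) => //; exact: cX|exact: cX].
have cf : continuous trace by exact: cp.
have cdf : continuous dtrace.
  apply: (cD); last by apply: (cM) => //; exact: (cp (dx2 u)).
  apply: (cM); last exact: (cp (dx1 u)).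
  by move=> t; apply: cvgN; exact: cs.
have cf9 : continuous (fun th => trace th - 1 / 9) by exact: cB.
by split; [apply: (cB)|apply: (cD)]; do ?[exact: (cM)]; apply: (cM) => //; exact: cM.
Qed.

(** Identifies the angular coefficients with the first integrals, through (1 + t^2)^-1 = (s cos
    th)^2. The factor s appears because the real cubic harmonic is odd in x and the imaginary one
    even; the minus sign in [coefB] is that of the Wronskian. *)
Lemma coef_slope s th : s * s = 1 -> 0 < s * cos th ->
  let t := sin th / (s * cos th) in
  let h := u (s, t) in let h' := dx2 u (s, t) in
  let rho := (1 + t ^+ 2)^-1 ^+ 2 * Num.sqrt (1 + t ^+ 2) in
  coefA th = s * ((h * (1 - t ^+ 2) - h' * (t - t ^+ 3 / 3)) * (1 + t ^+ 2)^-1 ^+ 2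
    - (1 - 3 * t ^+ 2) / 9 * rho) /\
  coefB th = - ((h * (- 2 * t) - h' * ((1 - 3 * t ^+ 2) / 3)) * (1 + t ^+ 2)^-1 ^+ 2
    + (3 * t - t ^+ 3) / 9 * rho).
Proof.
move=> ss k0 t h h' rho.
have kn : s * cos th != 0 by rewrite gt_eqF.
pose c := s * cos th; pose T := sin th.
have cE : cos th = s * c by rewrite /c mulrA ss mul1r.
have cT : c ^+ 2 + T ^+ 2 = 1.
  rewrite -(cos2Dsin2 th) /c /T; congr (_ + _).
  by rewrite exprMn expr2 ss mul1r.
have c0 : c != 0 by [].
have tE : t = T / c by [].
have wE : (1 + t ^+ 2)^-1 = c ^+ 2.
  have -> : 1 + t ^+ 2 = (c ^+ 2)^-1.
    by transitivity ((c ^+ 2 + T ^+ 2) / c ^+ 2); [rewrite tE; field|rewrite cT mul1r].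
  by rewrite invrK.
have vE : Num.sqrt (1 + t ^+ 2) = c^-1.
  by rewrite -[1 + t ^+ 2]invrK wE -exprVn sqrtr_sqr gtr0_norm// invr_gt0.
have fE : trace th = c ^+ 3 * h by exact: homogeneous_slope.
have dE : dtrace th = s * (- 3 * T * c ^+ 2 * h + c * h').
  rewrite /dtrace (slope_dx1 _ ss k0) (slope_dx2 _ ss k0) -/t -/h -/h' -/c -/T.
  (* Here and below the unit factor c^2 + T^2 is inserted by hand where the trigonometric relation
     is used; the rest is field arithmetic. *)
  transitivity (s * (- 3 * T * c ^+ 2 * h + c * h' * (c ^+ 2 + T ^+ 2))).
    by rewrite cE tE; field.
  by rewrite cT mulr1.
have c3E : cos3 th = s * (c ^+ 3 - 3 * c * T ^+ 2).
  rewrite /cos3 cE -/T.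
  transitivity (s * s * s * c ^+ 3 - 3 * s * c * T ^+ 2); first by ring.
  by rewrite ss; ring.
have s3E : sin3 th = 3 * c ^+ 2 * T - T ^+ 3.
  rewrite /sin3 cE -/T.
  transitivity (3 * (s * s) * c ^+ 2 * T - T ^+ 3); first by ring.
  by rewrite ss; ring.
rewrite /coefA /coefB /rho wE vE fE dE c3E s3E tE; split.
  transitivity (s * ((h * (c ^+ 2 * (c ^+ 2 - T ^+ 2)) * (c ^+ 2 + T ^+ 2)) -
     h' * (c ^+ 3 * T - c * T ^+ 3 / 3) - (c ^+ 3 - 3 * c * T ^+ 2) / 9)).
    by field.
  by rewrite cT; field.
transitivity ((c ^+ 3 * h - 1 / 9) * (3 * c ^+ 2 * T - T ^+ 3) + s * s *
   ((- 3 * T * c ^+ 2 * h + c * h') * (c ^+ 3 - 3 * c * T ^+ 2) / 3)); first by field.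
rewrite ss.
transitivity (h * 2 * c ^+ 3 * T * (c ^+ 2 + T ^+ 2) +
   h' * (c ^+ 4 - 3 * c ^+ 2 * T ^+ 2) / 3 - (3 * c ^+ 2 * T - T ^+ 3) / 9).
  by field.
by rewrite cT; field.
Qed.


End Angular.

(** * Trigonometry and zeros of continuous functions *)

Section Trigonometry.
Variable R : realType.
Implicit Types (x y z th : R).

Lemma cos3E th : cos3 th = cos (3 * th).
Proof.
have -> : 3 * th = th + th + th by ring.
rewrite !(cosD, sinD) /cos3.
by ring.
Qed.

Lemma sin3E th : sin3 th = sin (3 * th).
Proof.
have -> : 3 * th = th + th + th by ring.
by rewrite !(cosD, sinD) /sin3; ring.
Qed.

Lemma cos_lt1 x : 0 < x < 2 * pi -> cos x < 1.
Proof.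
move=> x02; have -> : x = (x / 2) *+ 2 by rewrite -mulr_natr divfK.
rewrite cos_mulr2n cos2sin2.
have s0 : 0 < sin (x / 2) by apply: sin_gt0_pi; lra.
have := exprn_gt0 2 s0.
by rewrite -mulr_natr; lra.
Qed.

Lemma cosD2pi1 x : cos (x + 2 * pi) = cos x.
Proof. by rewrite mulr_natl cosD2pi. Qed.

Lemma sinD2pi1 x : sin (x + 2 * pi) = sin x.
Proof. by rewrite mulr_natl sinD2pi. Qed.

Lemma cos_sinDint x (n : int) :
  cos (x + n%:~R * (2 * pi)) = cos x /\ sin (x + n%:~R * (2 * pi)) = sin x.
Proof.
have H (k : nat) y : cos (y + k%:R * (2 * pi)) = cos y /\ sin (y + k%:R * (2 * pi)) = sin y.
  elim: k => [|k [IHc IHs]]; first by rewrite mul0r addr0.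
  by rewrite -natr1 mulrDl mul1r addrA cosD2pi1 sinD2pi1.
case: n => n; first exact: H.
rewrite NegzE mulrNz mulNr; set y := x - _.
by have [<- <-] := H n.+1 y; rewrite /y subrK.
Qed.

Lemma polar_angle_unit x y : x ^+ 2 + y ^+ 2 = 1 ->
  exists th, cos th = x /\ sin th = y.
Proof.
move=> xy; have x1 : -1 <= x <= 1.
  by rewrite -ler_norml -(expr_le1 (n := 2))// real_normK ?num_real// -xy lerDl sqr_ge0.
have sy : Num.sqrt (1 - x ^+ 2) = `|y|.
  by rewrite -xy addrAC subrr add0r sqrtr_sqr.
have xin : x \in `[-1, 1] by rewrite in_itv.
have [y0|y0] := leP 0 y.
  by exists (acos x); rewrite acosK// sin_acos// sy ger0_norm.
by exists (- acos x); rewrite cosN sinN acosK// sin_acos// sy ltr0_norm// opprK.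
Qed.

Lemma shift_2pi (a x : R) : exists n : int,
  a <= x + n%:~R * (2 * pi) < a + 2 * pi.
Proof.
have p0 : 0 < 2 * pi :> R by rewrite mulr_gt0// pi_gt0.
exists (- Num.floor ((x - a) / (2 * pi))).
have /andP[f1 f2] := floor_itv ((x - a) / (2 * pi)).
move: f1 f2; rewrite ler_pdivlMr// ltr_pdivrMr// intrD mulrNz.
rewrite -[1%:~R]/(1 : R); move: (_%:~R) => k.
by rewrite mulrDl mulNr mul1r; lra.
Qed.

Lemma polar_coordinates (a : R) (p : R * R) : p <> 0 ->
  exists r th, [/\ 0 < r, a <= th < a + 2 * pi & p = (r * cos th, r * sin th)].
Proof.
case: p => x y p0; pose r := Num.sqrt (x ^+ 2 + y ^+ 2).
have rr : 0 < x ^+ 2 + y ^+ 2.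
  rewrite lt_neqAle addr_ge0 ?sqr_ge0// andbT eq_sym paddr_eq0 ?sqr_ge0//.
  by rewrite !sqrf_eq0; apply/negP => /andP[/eqP x0 /eqP y0]; apply: p0; rewrite x0 y0.
have r0 : 0 < r by rewrite sqrtr_gt0.
have rn : r != 0 by rewrite gt_eqF.
have [th [cth sth]] : exists th, cos th = x / r /\ sin th = y / r.
  apply: polar_angle_unit; rewrite !exprMn -mulrDl exprVn sqr_sqrtr ?ltW//.
  by rewrite divff// gt_eqF.
have [n nth] := shift_2pi a th.
have [cn sn] := cos_sinDint th n.
exists r, (th + n%:~R * (2 * pi)); split => //.
by rewrite cn sn cth sth ![r * _]mulrC !divfK.
Qed.

(** The radii agree by summing squares; then cos |x - y| = 1, impossible for 0 < |x - y| < 2 pi. *)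
Lemma polar_inj r r' x y : 0 < r -> 0 < r' -> `|x - y| < 2 * pi ->
  r * cos x = r' * cos y -> r * sin x = r' * sin y -> x = y.
Proof.
move=> r0 r'0 xy c s.
have rr : r = r'.
  apply: (pexpIrn (n := 2)) => //; rewrite ?nnegrE ?ltW//.
  rewrite -[LHS]mulr1 -(cos2Dsin2 x) -[RHS]mulr1 -(cos2Dsin2 y).
  by rewrite !mulrDr -!exprMn c s.
have {}c : cos x = cos y by apply: (mulfI (lt0r_neq0 r0)); rewrite c rr.
have {}s : sin x = sin y by apply: (mulfI (lt0r_neq0 r0)); rewrite s rr.
have c1 : cos `|x - y| = 1.
  by rewrite cos_norm cosB c s -!expr2 cos2Dsin2.
have [xy0|xy0] := leP `|x - y| 0.
  by apply/eqP; rewrite -subr_eq0 -normr_le0.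
have := @cos_lt1 `|x - y|; rewrite xy0 xy c1 ltxx.
by move=> /(_ isT).
Qed.

(** Mean value theorem with derivative 0. Local constancy is demanded in the open interval only, and
    continuity reaches the endpoints: this is how the coefficients arrive at zeros of the trace. *)
Lemma near_const_eq (F : R -> R) (a b : R) : a < b -> continuous F ->
  (forall x, a < x < b -> \forall y \near x, F y = F x) -> F a = F b.
Proof.
move=> ab cF F0.
have [|c _] := @MVT R F (fun=> 0) a b ab _ (continuous_subspaceT cF).
  move=> x; rewrite in_itv/= => xab.
  apply: (@near_eq_is_derive _ _ _ (fun=> F x)).
  by apply: filterS (F0 x xab) => y ->.
by rewrite mul0r => /eqP; rewrite subr_eq0 => /eqP.
Qed.

Lemma last_zero (F : R -> R) (a b : R) : continuous F -> a <= b -> F a = 0 ->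
  F b != 0 -> exists c, [/\ a <= c < b, F c = 0 & forall x, c < x <= b -> F x != 0].
Proof.
move=> cF ab Fa Fb.
pose E := [set x | a <= x <= b /\ F x = 0].
have Ea : E a by split => //; rewrite lexx.
have hE : has_sup E by split; [exists a|exists b => x [/andP[]]].
have aS : a <= sup E by apply: sup_upper_bound.
have Sb : sup E <= b by apply: sup_le_ub => [|x [/andP[]]//]; exists a.
have FS : F (sup E) = 0.
  apply/eqP; apply: contrapT => /negP FS.
  have [e /= e0 He] : \forall x \near sup E, F x != 0.
    exact: (cvgr_neq0 (F (sup E)) (cF _)).
  have [x [xab Fx] xS] := sup_adherent e0 hE.
  have xS' : x <= sup E by apply: sup_upper_bound.
  have : F x != 0 by apply: He; rewrite /= ltr_norml; lra.
  by rewrite Fx eqxx.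
exists (sup E); split => //.
  rewrite aS lt_neqAle Sb andbT; apply: contra Fb => /eqP <-.
  by rewrite FS.
move=> x /andP[Sx xb]; apply/eqP => Fx.
have : x <= sup E.
  by apply: sup_upper_bound => //; split => //; rewrite xb (le_trans aS (ltW Sx)).
by rewrite leNgt Sx.
Qed.

Lemma first_zero (F : R -> R) (a b : R) : continuous F -> a <= b -> F b = 0 ->
  F a != 0 -> exists c, [/\ a < c <= b, F c = 0 & forall x, a <= x < c -> F x != 0].
Proof.
move=> cF ab Fb Fa.
have cG : continuous (fun x => F (- x)).
  move=> x; apply: (@continuous_comp _ _ _ (fun x => - x) F); last exact: cF.
  exact: opp_continuous.
have [| | |c [acb Fc H]] := @last_zero (fun x => F (- x)) (- b) (- a) cG.
- by rewrite lerN2.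
- by rewrite opprK.
- by rewrite opprK.
exists (- c); split => //; first lra.
move=> x xac; have := H (- x); rewrite opprK; apply; lra.
Qed.

End Trigonometry.

(** * Classification *)

Section Classification.
Variable R : realType.
Implicit Types (c d s t x y z th al be : R) (p : R * R).
Variable u : R * R -> R.
Hypothesis u_sol : homogeneous_global_solution u.

Let f := trace u.
Let A := coefA u.
Let B := coefB u.

Let u_ge0 p : 0 <= u p. Proof. by have [_ u0 _ _] := u_sol. Qed.

Let u_hom : homogeneous 3 u. Proof. by have [] := u_sol. Qed.

Let udiff p v : derivable u p v.
Proof. by have [[du _] _ _ _] := u_sol; exact: diff_derivable. Qed.

Let cA : continuous A. Proof. by have [] := continuous_coef u_sol. Qed.
Let cB : continuous B. Proof. by have [] := continuous_coef u_sol. Qed.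

Let cf : continuous f.
Proof.
have [[du _] _ _ _] := u_sol.
move=> th; apply: (@continuous_comp _ _ _ (fun th => (cos th, sin th)) u).
  exact: (cvg_pair (@continuous_cos R th) (@continuous_sin R th)).
exact: differentiable_continuous.
Qed.

(** With s the sign of cos th, u (s, .) stays positive on a slope interval around the slope of th.
    Both first integrals are constant there, and nearby angles have their slopes in that
    interval. *)
Lemma coef_near_regular th : 0 < f th -> cos th != 0 ->
  \forall x \near th, A x = A th /\ B x = B th.
Proof.
move=> f0 c0.
have [_ _ _ lapl] := u_sol.
have [s [s1 k0]] : exists s : R, (s = 1 \/ s = -1) /\ 0 < s * cos th.
  have [c1|c1] := ltP 0 (cos th); first by exists 1; rewrite mul1r; split; [left|].
  by exists (-1); rewrite mulN1r oppr_gt0 lt_neqAle c0 c1; split; [right|].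
have ss : s * s = 1 by case: s1 => ->; rewrite ?mulrNN mulr1.
pose tau x := sin x / (s * cos x).
have ctau : tau x @[x --> th] --> tau th.
  apply: cvgM; first exact: continuous_sin.
  apply: cvgV; first by rewrite gt_eqF.
  by apply: cvgM; [exact: cvg_cst|exact: continuous_cos].
have dh t : is_derive t 1 (fun t => u (s, t)) (dx2 u (s, t)).
  by have := derivable_snd (@udiff (s, t) (0, 1)).
have ch : continuous (fun t => u (s, t)) := is_derive_continuous dh.
have ch' : continuous (fun t => dx2 u (s, t)).
  have [[_ lu] _ _ _] := u_sol.
  move=> t; apply: (@continuous_comp _ _ _ (fun t => (s, t)) (dx2 u)).
    exact: (cvg_pair (cvg_cst s) (@cvg_id _ _)).
  by apply: lipschitz_compact_continuous => K /lu[].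
have h0 : 0 < u (s, tau th).
  move: f0; rewrite /f /trace (homogeneous_slope _ ss u_hom k0) pmulr_rgt0//.
  exact: exprn_gt0.
have [e /= e0 He] : \forall t \near tau th, 0 < u (s, t).
  exact: (cvgr_gt _ (ch (tau th))).
pose c := tau th - e / 2; pose d := tau th + e / 2.
have cd : c < d by rewrite /c /d; lra.
have hcd t : c <= t <= d -> 0 < u (s, t).
  by move=> tcd; apply: He; rewrite /= ltr_norml; move: tcd; rewrite /c /d; lra.
have Icos := slope_first_integral_cos s1 cd u_hom lapl dh ch' hcd.
have Isin := slope_first_integral_sin s1 cd u_hom lapl dh ch' hcd.
have thcd : c < tau th < d by rewrite /c /d; lra.
have n1 : \forall x \near th, 0 < s * cos x.
  have cl : s * cos x @[x --> th] --> s * cos th.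
    by apply: cvgM; [exact: cvg_cst|exact: continuous_cos].
  exact: (cvgr_gt _ cl).
have n2 : \forall x \near th, c < tau x by apply: (cvgr_gt _ ctau); case/andP: thcd.
have n3 : \forall x \near th, tau x < d by apply: (cvgr_lt _ ctau); case/andP: thcd.
near=> x.
have kx : 0 < s * cos x by near: x.
have xcd : c < tau x < d by apply/andP; split; near: x.
rewrite /A /B; have [-> ->] := coef_slope u_sol ss kx.
have [-> ->] := coef_slope u_sol ss k0.
by rewrite (Icos _ _ xcd thcd) (Isin _ _ xcd thcd).
Unshelve. all: by end_near. Qed.

(** If cos th = 0, the cosine has no other zero within distance pi, so a punctured neighbourhood of
    th consists of regular angles; constancy on either side extends to th by continuity of the
    coefficients. *)
Lemma coef_near th : 0 < f th -> \forall x \near th, A x = A th /\ B x = B th.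
Proof.
move=> f0; have [c0|] := eqVneq (cos th) 0; last exact: coef_near_regular.
have s0 : sin th != 0.
  apply/eqP => s0; have := cos2Dsin2 th.
  by rewrite c0 s0 !expr0n addr0 => /eqP; rewrite eq_sym oner_eq0.
have [e /= e0 He] : \forall x \near th, 0 < f x.
  exact: (cvgr_gt _ (@cf th)).
have pi0 := @pi_gt0 R.
pose r := Num.min e pi.
have r0 : 0 < r by rewrite lt_min e0.
have reg x : 0 < `|x - th| < r -> 0 < f x /\ cos x != 0.
  rewrite lt_min => /and3P[x0 xe xp]; split.
    by apply: He; rewrite /= distrC.
  have -> : x = th + (x - th) by ring.
  rewrite cosD c0 mul0r sub0r oppr_eq0 mulf_neq0//.
  have : 0 < sin `|x - th| by apply: sin_gt0_pi; rewrite x0.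
  have [?|?] := ger0P (x - th); rewrite ?sinN; lra.
have step x y : x < y -> (forall z, x < z < y -> 0 < `|z - th| < r) ->
    A x = A y /\ B x = B y.
  move=> xy H; split; (apply: near_const_eq => // z /H /reg[fz cz]);
    by apply: filterS (coef_near_regular fz cz) => ? [].
exists r => //= x xr.
have [xth|xth|->//] := ltgtP x th.
  apply: step => // z zxy; rewrite ltr0_norm; last lra.
  by move: xr => /=; rewrite gtr0_norm; lra.
have [] := step th x xth _; last by move=> -> ->.
move=> z zxy; rewrite gtr0_norm; last lra.
by move: xr => /=; rewrite ltr0_norm; lra.
Qed.

Lemma coef_const al be : al <= be -> (forall x, al < x < be -> 0 < f x) ->
  A al = A be /\ B al = B be.
Proof.
rewrite le_eqVlt => /predU1P[->//|ab] H.
by split; apply: near_const_eq => // x /H /coef_near; apply: filterS => ? [].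
Qed.

Lemma coef_zero z : f z = 0 -> A z = - cos3 z / 9 /\ B z = - sin3 z / 9.
Proof.
move=> fz.
have H (F : R -> R) x e : is_derive x 1 F e -> (forall y, derivable F y 1) ->
    (forall y, F x <= F y) -> e = 0.
  move=> dF DF Fm.
  have [_ <-] : is_derive x 1 F 0.
    apply: (@derive1_at_min _ F (x - 1) (x + 1)) => //.
      by lra.
    by rewrite in_itv/=; lra.
  by case: dF.
have u1 : dx1 u (cos z, sin z) = 0.
  apply: (H _ _ _ (derivable_fst (@udiff (cos z, sin z) (1, 0)))) => y /=.
    by case: (derivable_fst (@udiff (y, sin z) (1, 0))).
  by rewrite -/(trace u z) -/f fz.
have u2 : dx2 u (cos z, sin z) = 0.
  apply: (H _ _ _ (derivable_snd (@udiff (cos z, sin z) (0, 1)))) => y /=.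
    by case: (derivable_snd (@udiff (cos z, y) (0, 1))).
  by rewrite -/(trace u z) -/f fz.
have d0 : dtrace u z = 0 by rewrite /dtrace u1 u2 !mulr0 addr0.
rewrite /A /B /coefA /coefB d0 -/f fz.
by split; field.
Qed.

(** Constancy of the coefficients reaches back to z, where they are known; the subtraction formula
    for the cosine does the rest. *)
Lemma arc_formula z th : f z = 0 -> z <= th -> (forall x, z < x < th -> 0 < f x) ->
  f th = (1 - cos (3 * (th - z))) / 9.
Proof.
move=> fz zth H; have [Az Bz] := coef_zero fz.
have [Ath Bth] := coef_const zth H.
rewrite /f traceE -/A -/B -Ath -Bth Az Bz !cos3E !sin3E mulrBr cosB.
by field.
Qed.

(** A positivity arc encoded by its starting angle alone, the length being forced. Taking the closed
    interval includes the zeros at both ends. *)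
Definition arc_start al :=
  forall x, al <= x <= al + 2 * pi / 3 -> f x = (1 - cos (3 * (x - al))) / 9.

Let pi0 : 0 < pi :> R := pi_gt0 R.

Lemma arc_start_gt0 al x : arc_start al -> al < x < al + 2 * pi / 3 -> 0 < f x.
Proof.
move=> sal xal; rewrite sal; last lra.
rewrite divr_gt0// subr_gt0; apply: cos_lt1; lra.
Qed.

Lemma arc_start_eq0 al : arc_start al -> f al = 0.
Proof. by move=> ->; [rewrite subrr mulr0 cos0 subrr mul0r|move: pi0; lra]. Qed.

Lemma arc_start_end_eq0 al : arc_start al -> f (al + 2 * pi / 3) = 0.
Proof.
move=> ->; last by move: pi0; lra.
rewrite (_ : 3 * _ = 0 + 2 * pi); last by field.
by rewrite cosD2pi1 cos0 subrr mul0r.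
Qed.

(** Otherwise the start of the second arc, a zero, would lie in the open first arc. *)
Lemma arc_start_sep al be : arc_start al -> arc_start be -> al < be ->
  al + 2 * pi / 3 <= be.
Proof.
move=> sal sbe ab; rewrite leNgt; apply/negP => h.
have := @arc_start_gt0 al be sal; rewrite ab h (arc_start_eq0 sbe) ltxx.
by move=> /(_ isT).
Qed.

Lemma trace_shift x (n : int) : f (x + n%:~R * (2 * pi)) = f x.
Proof. by rewrite /f /trace; have [-> ->] := cos_sinDint x n. Qed.

Lemma arc_start_shift al (n : int) : arc_start al -> arc_start (al + n%:~R * (2 * pi)).
Proof.
move=> sal x xal.
rewrite -(subrK (n%:~R * (2 * pi)) x) trace_shift sal; last first.
  by move: (n%:~R * _) xal => k; lra.
by move: (n%:~R * _) => k; congr ((1 - cos _) / 9); ring.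
Qed.

Lemma exists_arc th : (exists z, f z = 0) -> 0 < f th ->
  exists al, arc_start al /\ al < th < al + 2 * pi / 3.
Proof.
move=> [z fz] fth.
have fge0 x : 0 <= f x by exact: u_ge0.
have pos x : f x != 0 -> 0 < f x by rewrite lt_neqAle eq_sym fge0 andbT.
(* Translates of one zero by multiples of 2 pi give zeros on both sides of th; [al] and [ga] are the
   nearest ones. *)
have [n nz] := shift_2pi (th - 2 * pi) z.
have [m mz] := shift_2pi th z.
have fn : f (z + n%:~R * (2 * pi)) = 0 by rewrite trace_shift.
have fm : f (z + m%:~R * (2 * pi)) = 0 by rewrite trace_shift.
have fth' : f th != 0 by rewrite gt_eqF.
have [|al [al1 fal Hal]] := last_zero cf _ fn fth'.
  by move: nz; set k := z + _; lra.
have [|ga [ga1 fga Hga]] := first_zero cf _ fm fth'.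
  by move: mz; set k := z + _; lra.
have alth : al < th by case/andP: al1.
have thga : th < ga by case/andP: ga1.
have Hpos x : al < x < ga -> 0 < f x.
  move=> /andP[x1 x2]; apply: pos; have [xth|xth] := leP x th.
    by apply: Hal; rewrite x1.
  by apply: Hga; rewrite x2 ltW.
have F x : al <= x <= ga -> f x = (1 - cos (3 * (x - al))) / 9.
  move=> /andP[x1 x2]; apply: arc_formula => // y /andP[y1 y2].
  by apply: Hpos; rewrite y1 (lt_le_trans y2).
(* A shorter arc would end where the formula is still positive; a longer one would contain the zero
   of the formula at al + 2 pi / 3. *)
have gaE : ga = al + 2 * pi / 3.
  have [ge|ge|//] := ltgtP ga (al + 2 * pi / 3).
    have : cos (3 * (ga - al)) < 1 by apply: cos_lt1; lra.
    have : f ga = (1 - cos (3 * (ga - al))) / 9 by apply: F; lra.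
    by rewrite fga; lra.
  have : 0 < f (al + 2 * pi / 3) by apply: Hpos; move: pi0; lra.
  rewrite F; last by move: pi0; lra.
  rewrite (_ : 3 * _ = 0 + 2 * pi); last by field.
  by rewrite cosD2pi1 cos0 subrr mul0r ltxx.
exists al; split; first by move=> x; rewrite -gaE; exact: F.
by rewrite -gaE alth thga.
Qed.

Lemma homogeneous_polar r th : 0 < r -> u (r * cos th, r * sin th) = r ^+ 3 * f th.
Proof. by move=> r0; rewrite -u_hom. Qed.

Lemma u0 : u 0 = 0.
Proof.
have := @u_hom 2 0; rewrite scaler0 ltr0n => /(_ isT).
by rewrite -natrX; lra.
Qed.

Lemma enorm_polar r th : 0 < r -> enorm (r * cos th, r * sin th) = r.
Proof.
move=> r0; rewrite /enorm/= !exprMn -mulrDr cos2Dsin2 mulr1 sqrtr_sqr.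
by rewrite gtr0_norm.
Qed.

Lemma profile_polar al r th : 0 < r ->
  profile al (r * cos th, r * sin th) = r ^+ 3 * ((1 - cos (3 * (th - al))) / 9).
Proof.
move=> r0; rewrite /profile enorm_polar//= [3 * (th - al)]mulrBr cosB.
by rewrite -(cos3E th) -(sin3E th) /cos3 /sin3; field.
Qed.

Lemma profile0 al : profile al (0 : R * R) = 0.
Proof.
by rewrite /profile /enorm /= !expr0n /= !(mulr0, addr0, subr0, sqrtr0) ?expr0n /= ?mul0r.
Qed.

(** [sector] takes angles modulo 2 pi; within one window of length 2 pi containing the sector,
    [polar_inj] turns membership into an inequality on th. *)
Lemma indic_sector (a : R) al be r th : 0 < r -> a <= th < a + 2 * pi ->
  a <= al -> be <= a + 2 * pi ->
  \1_(sector al be) (r * cos th, r * sin th) = ((al < th < be)%R)%:R :> R.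
Proof.
move=> r0 tha aal bea; rewrite indicE; congr (_ %:R); congr nat_of_bool.
apply/idP/idP; rewrite inE /sector /=.
  move=> [r' [t [r'0 tab [cE sE]]]].
  by rewrite (@polar_inj _ r r' th t)// ltr_norml; lra.
by move=> h; exists r, th.
Qed.

(** At the two ends of the arc the open indicator drops a value that is already 0. *)
Lemma arc_indic al x : arc_start al -> al <= x <= al + 2 * pi / 3 ->
  f x = (1 - cos (3 * (x - al))) / 9 * ((al < x < al + 2 * pi / 3)%R)%:R.
Proof.
move=> sal /andP[x1 x2].
have [h|h] := boolP (al < x < al + 2 * pi / 3).
  by rewrite mulr1 sal// x1 x2.
rewrite mulr0; move: h; rewrite negb_and -!leNgt => /orP[h|h].
  by rewrite (_ : x = al) ?arc_start_eq0//; apply/eqP; rewrite eq_le h x1.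
rewrite (_ : x = al + 2 * pi / 3) ?arc_start_end_eq0//.
by apply/eqP; rewrite eq_le h x2.
Qed.

(** The new arc must be separated from the arc at al and from its copy at al + 2 pi; this leaves its
    start a range of length 2 pi / 3, the origin of the bound on the gap in the two-arc form. *)
Lemma next_arc al x : arc_start al ->
  al + 2 * pi / 3 <= x <= al + 2 * pi -> f x != 0 ->
  exists be, [/\ arc_start be, be < x < be + 2 * pi / 3
    & al + 2 * pi / 3 <= be <= al + 4 * pi / 3].
Proof.
move=> sal xal fx.
have f0 : 0 < f x by rewrite lt_neqAle eq_sym fx u_ge0.
have [|be [sbe xbe]] := exists_arc _ f0; first by exists al; exact: arc_start_eq0.
exists be; split => //.
have al2 : arc_start (al + 2 * pi).
  by have := @arc_start_shift al 1 sal; rewrite mul1r.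
have xn : x != al + 2 * pi.
  by apply: contra fx => /eqP ->; rewrite (arc_start_eq0 al2).
have x2 : x < al + 2 * pi by rewrite lt_neqAle xn; lra.
have h1 : be < al + 2 * pi by lra.
have h2 := arc_start_sep sbe al2 h1.
have h3 : al < be.
  rewrite ltNge; apply/negP; rewrite le_eqVlt => /predU1P[E|h]; first by move: xbe; rewrite E; lra.
  by have := arc_start_sep sbe sal h; lra.
have h4 := arc_start_sep sal sbe h3.
by lra.
Qed.

Lemma eq_polar (a : R) (G : R * R -> R) : G 0 = 0 ->
  (forall r th, 0 < r -> a <= th < a + 2 * pi ->
     r ^+ 3 * f th = G (r * cos th, r * sin th)) ->
  forall p, u p = G p.
Proof.
move=> G0 H p; have [->|/eqP p0] := eqVneq p 0; first by rewrite u0 G0.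
have [r [th [r0 tha ->]]] := polar_coordinates a p0.
by rewrite homogeneous_polar// H.
Qed.

Lemma no_zero_case : (forall z, f z != 0) -> exists a b : R,
  Num.sqrt (a ^+ 2 + b ^+ 2) < 1 / 9 /\
  forall p, u p =
    enorm p ^+ 3 / 9 + a * (p.1 ^+ 3 - 3 * p.1 * p.2 ^+ 2)
    + b * (3 * p.1 ^+ 2 * p.2 - p.2 ^+ 3).
Proof.
move=> f0; have fpos x : 0 < f x by rewrite lt_neqAle eq_sym f0 u_ge0.
have AB x : A x = A 0 /\ B x = B 0.
  have [x0|x0] := leP x 0; first by exact: coef_const.
  by have [-> ->] := coef_const (ltW x0) (fun y _ => fpos y).
have fE x : f x = 1 / 9 + A 0 * cos3 x + B 0 * sin3 x.
  by have [<- <-] := AB x; exact: traceE.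
exists (A 0), (B 0); split.
  set rho := Num.sqrt _; rewrite ltNge; apply/negP => hr.
  have r0 : 0 < rho by lra.
  have rE : rho ^+ 2 = A 0 ^+ 2 + B 0 ^+ 2.
    by rewrite sqr_sqrtr// addr_ge0// sqr_ge0.
  (* At the angle ph / 3, where (cos3, sin3) is opposite to (A 0, B 0), the trace equals 1/9 - rho,
     which [hr] would make nonpositive. *)
  have [|ph [cph sph]] := @polar_angle_unit R (- A 0 / rho) (- B 0 / rho).
    by rewrite !exprMn !sqrrN -mulrDl -rE exprVn divff// gt_eqF// exprn_gt0.
  have := fpos (ph / 3); rewrite fE cos3E sin3E [3 * _]mulrC divfK// cph sph.
  have -> : 1 / 9 + A 0 * (- A 0 / rho) + B 0 * (- B 0 / rho) =
      1 / 9 - (A 0 ^+ 2 + B 0 ^+ 2) / rho by field; rewrite gt_eqF.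
  by rewrite -rE expr2 mulfK ?gt_eqF//; lra.
apply: (@eq_polar 0).
  by rewrite /enorm /= !expr0n /= !(mulr0, addr0, subr0, sqrtr0) ?expr0n /= ?mul0r ?addr0.
by move=> r th r0 _; rewrite enorm_polar// fE /cos3 /sin3 /=; field.
Qed.

Lemma zero_case : (exists z, f z = 0) -> ~ (forall p, u p = 0) ->
  exists theta1 theta2 : R,
     [/\ 0 <= theta1 < 2 * pi, theta2 = theta1 + 2 * pi / 3 &
         [\/ (forall p, u p = profile theta1 p * \1_(sector theta1 theta2) p),
             (exists s theta3 : R,
                [/\ 0 <= s <= 2 * pi / 3, theta3 = theta2 + s &
                    forall p, u p =
                      profile theta1 p * \1_(sector theta1 theta2) p +
                      profile theta3 p *
                        \1_(sector theta3 (theta3 + 2 * pi / 3)) p])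
           | (forall p, u p =
                profile theta1 p *
                  (\1_(sector theta1 theta2) p +
                   \1_(sector theta2 (theta2 + 2 * pi / 3)) p +
                   \1_(sector (theta2 + 2 * pi / 3)
                              (theta2 + 4 * pi / 3)) p))]].
Proof.
move=> ez /existsNP[p /eqP up].
have pi0' := pi0.
have [al0 sal0] : exists al, arc_start al.
  have p0 : p <> 0 by move=> p0; move: up; rewrite p0 u0 eqxx.
  have [r [th [r0 _ pE]]] := polar_coordinates 0 p0.
  have [|al [sal _]] := @exists_arc th ez; last by exists al.
  rewrite lt_neqAle u_ge0 andbT eq_sym; apply: contra up => /eqP fth.
  by rewrite pE homogeneous_polar// -/f fth mulr0.
have [n th10] := shift_2pi 0 al0; have sth1 := @arc_start_shift al0 n sal0.
move: th10 sth1; set th1 := al0 + _; rewrite add0r => th10 sth1.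
exists th1, (th1 + 2 * pi / 3); split => //.
(* Either nothing is positive between the first arc and its return after 2 pi, or a second arc
   starts there. *)
have [H1|/existsNP[x /not_implyP[xth1 /eqP fx]]] := pselect (forall x,
    th1 + 2 * pi / 3 <= x <= th1 + 2 * pi -> f x = 0).
  apply: Or31; apply: (@eq_polar th1); first by rewrite profile0 mul0r.
  move=> r th r0 tha; rewrite profile_polar// (@indic_sector th1)//; last lra.
  rewrite -[RHS]mulrA; congr (_ * _).
  have [h|h] := leP th (th1 + 2 * pi / 3); first by rewrite -arc_indic//; lra.
  have -> : (th1 < th < th1 + 2 * pi / 3) = false by apply/negbTE; lra.
  by rewrite mulr0 H1//; lra.
have [al [sal xal al1]] := next_arc sth1 xth1 fx.
(* The same alternative off the first two arcs. *)
have [H2|/existsNP[y /not_implyP[yth1 /eqP fy]]] := pselect (forall x,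
    (th1 + 2 * pi / 3 <= x <= al) || (al + 2 * pi / 3 <= x <= th1 + 2 * pi) -> f x = 0).
  apply: Or32; exists (al - (th1 + 2 * pi / 3)), al; split; first lra.
    by ring.
  apply: (@eq_polar th1); first by rewrite !profile0 !mul0r addr0.
  move=> r th r0 tha; rewrite !profile_polar// !(@indic_sector th1)//; try lra.
  rewrite -[X in _ = X + _]mulrA -[X in _ = _ + X]mulrA -mulrDr; congr (_ * _).
  have [h|h] := leP th (th1 + 2 * pi / 3).
    rewrite -arc_indic//; last lra.
    have -> : (al < th < al + 2 * pi / 3) = false by apply/negbTE; lra.
    by rewrite mulr0 addr0.
  rewrite [th1 < _ < _](_ : _ = false) ?mulr0 ?add0r; last by apply/negbTE; lra.
  have [h'|h'] := boolP (al <= th <= al + 2 * pi / 3); first by rewrite -arc_indic.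
  have -> : (al < th < al + 2 * pi / 3) = false by apply/negbTE; lra.
  by rewrite mulr0 H2//; lra.
have [|be [sbe ybe be1]] := next_arc sth1 _ fy; first lra.
(* The point [y] lies inside the arc of [be] but off that of [al]. *)
have albe : al != be.
  by apply/eqP => E; move: ybe yth1; rewrite -E; lra.
(* Three separated arcs of length 2 pi / 3 fill the circle, so the starts are forced, whichever of
   [al] and [be] comes first. *)
have [s1 s2] : arc_start (th1 + 2 * pi / 3) /\ arc_start (th1 + 4 * pi / 3).
  move: albe; rewrite neq_lt => /orP[h|h].
    have h' := arc_start_sep sal sbe h.
    have -> : th1 + 2 * pi / 3 = al by lra.
    by have -> : th1 + 4 * pi / 3 = be by lra.
  have h' := arc_start_sep sbe sal h.
  have -> : th1 + 2 * pi / 3 = be by lra.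
  by have -> : th1 + 4 * pi / 3 = al by lra.
apply: Or33; apply: (@eq_polar th1); first by rewrite profile0 mul0r.
move=> r th r0 tha; rewrite profile_polar// !(@indic_sector th1)//; try lra.
rewrite -[RHS]mulrA; congr (_ * _).
(* Moving the start by 2 pi / 3 changes the argument of the cosine by 2 pi, so one profile serves
   all three arcs. *)
have e1 : 3 * (th - th1) = 3 * (th - (th1 + 2 * pi / 3)) + 2 * pi by field.
have e2 : 3 * (th - th1) = 3 * (th - (th1 + 4 * pi / 3)) + 2 * pi + 2 * pi by field.
have [b bE] : exists b : R, b = th1 + 2 * pi / 3 by exists (th1 + 2 * pi / 3).
rewrite -!bE.
have le_or_lt (v w : R) : v <= w \/ w < v by case: leP => _; [left|right].
have [h|h] := le_or_lt th b.
  have -> : (b < th < b + 2 * pi / 3) = false by apply/negbTE; lra.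
  have -> : (b + 2 * pi / 3 < th < b + 4 * pi / 3) = false.
    by apply/negbTE; move: pi0'; lra.
  by rewrite !addr0 bE -arc_indic//; lra.
have -> : (th1 < th < b) = false by apply/negbTE; lra.
have [h'|h'] := le_or_lt th (b + 2 * pi / 3).
  have -> : (b + 2 * pi / 3 < th < b + 4 * pi / 3) = false by apply/negbTE; lra.
  by rewrite add0r addr0 e1 cosD2pi1 bE -arc_indic//; lra.
have -> : (b < th < b + 2 * pi / 3) = false by apply/negbTE; lra.
rewrite !add0r e2 !cosD2pi1.
have -> : b + 2 * pi / 3 = th1 + 4 * pi / 3 by rewrite bE; field.
have -> : b + 4 * pi / 3 = th1 + 4 * pi / 3 + 2 * pi / 3 by rewrite bE; field.
by rewrite -arc_indic//; lra.
Qed.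

End Classification.

Unset Implicit Arguments.
Set Strict Implicit.

Theorem theorem1p3 (R : realType) (u : R * R -> R)
    (u_sol : homogeneous_global_solution u)
    (u_nontrivial : ~ (forall p, u p = 0)) :
  (exists theta1 theta2 : R,
     [/\ 0 <= theta1 < 2 * pi, theta2 = theta1 + 2 * pi / 3 &
         [\/ (forall p, u p = profile theta1 p * \1_(sector theta1 theta2) p),
             (exists s theta3 : R,
                [/\ 0 <= s <= 2 * pi / 3, theta3 = theta2 + s &
                    forall p, u p =
                      profile theta1 p * \1_(sector theta1 theta2) p +
                      profile theta3 p *
                        \1_(sector theta3 (theta3 + 2 * pi / 3)) p])
           | (forall p, u p =
                profile theta1 p *
                  (\1_(sector theta1 theta2) p +
                   \1_(sector theta2 (theta2 + 2 * pi / 3)) p +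
                   \1_(sector (theta2 + 2 * pi / 3)
                              (theta2 + 4 * pi / 3)) p))]]) \/
  (exists a b : R,
     Num.sqrt (a ^+ 2 + b ^+ 2) < 1 / 9 /\
     forall p, u p =
       enorm p ^+ 3 / 9 + a * (p.1 ^+ 3 - 3 * p.1 * p.2 ^+ 2)
       + b * (3 * p.1 ^+ 2 * p.2 - p.2 ^+ 3)).
Proof.
have [ez|nz] := pselect (exists z, trace u z = 0).
  by left; exact: zero_case.
by right; apply: no_zero_case => // z; apply/eqP => uz; apply: nz; exists z.
Qed.
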